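(* Let $(A_\mu,B_\nu,\vartriangleright,\vartriangleleft,\rightharpoonup,\leftharpoonup,\theta)$ be a quasi-twilled associative algebra. Let $\mathfrak a=\bigoplus_{n\ge0}\mathfrak a_n$ with $\mathfrak a_n=\mathrm{Hom}(A^{\otimes n+1},B)$. Then $(\mathfrak a,\{l_k\}_{k=0}^\infty)$ is a curved $L_\infty$-algebra, where for $f,g\in\mathfrak a$, $$l_0=\theta,\qquad l_1(f)=[\mu_{\vartriangleright,\vartriangleleft},f],\qquad l_2(f,g)=[[\nu_{\rightharpoonup,\leftharpoonup},f],g],\qquad l_k=0\ \text{ for }k\ge3.$$ Moreover, a linear map $D:A\to B$ is a strong deformation map in $(A_\mu,B_\nu,\vartriangleright,\vartriangleleft,\rightharpoonup,\leftharpoonup,\theta)$ if and only if $D\in\mathfrak a_0=\mathrm{Hom}(A,B)$ is a Maurer-Cartan element of this curved $L_\infty$-algebra.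
   Context: A quasi-twilled associative algebra is an associative algebra with a fixed vector space decomposition $\mathbb A=A\oplus B$ such that $B$ is a subalgebra. Its multiplication has the form $(a,x)\cdot_{\mathbb A}(b,y)=(a\cdot_A b+a\leftharpoonup y+x\rightharpoonup b,\ x\cdot_B y+a\vartriangleright y+x\vartriangleleft b+\theta(a,b))$ for unique bilinear maps $\mu=\cdot_A:A\times A\to A$, $\nu=\cdot_B:B\times B\to B$, $\vartriangleright:A\times B\to B$, $\vartriangleleft:B\times A\to B$, $\rightharpoonup:B\times A\to A$, $\leftharpoonup:A\times B\to A$, $\theta:A\times A\to B$; one writes it as the tuple $(A_\mu,B_\nu,\vartriangleright,\vartriangleleft,\rightharpoonup,\leftharpoonup,\theta)$. Put $\mu_{\vartriangleright,\vartriangleleft}((a,x),(b,y))=(a\cdot_A b,\ a\vartriangleright y+x\vartriangleleft b)$ and $\nu_{\rightharpoonup,\leftharpoonup}((a,x),(b,y))=(a\leftharpoonup y+x\rightharpoonup b,\ x\cdot_B y)$. A strong deformation map is a linear map $D:A\to B$ with $D(a\cdot_A b+a\leftharpoonup D(b)+D(a)\rightharpoonup b)=D(a)\cdot_B D(b)+a\vartriangleright D(b)+D(a)\vartriangleleft b+\theta(a,b)$ for all $a,b\in A$. Brackets are taken in the graded Lie algebra $\mathfrak g=\bigoplus_{n\ge0}\mathfrak g_n$, $\mathfrak g_n=\mathrm{Hom}((A\oplus B)^{\otimes n+1},A\oplus B)$, with the Gerstenhaber bracket: for $f$ with $m$ inputs and $g$ with $n$ inputs, $[f,g]=f\diamond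 g-(-1)^{(m-1)(n-1)}g\diamond f$, where $(f\diamond g)(v_1,\ldots,v_{m+n-1})=\sum_{i=1}^m(-1)^{(i-1)(n-1)}f(v_1,\ldots,v_{i-1},g(v_i,\ldots,v_{i+n-1}),v_{i+n},\ldots,v_{m+n-1})$. Maps $A^{\otimes n+1}\to B$ are regarded as elements of $\mathfrak g_n$ by extending them by zero, and $\mathfrak a\subset\mathfrak g$ in this way. A curved $L_\infty$-algebra is a graded vector space $\mathcal G$ with graded symmetric (with Koszul sign $\epsilon(\sigma)$) degree $1$ maps $l_k:\mathcal G^{\otimes k}\to\mathcal G$, $k\ge0$ (so $l_0\in\mathcal G_1$), such that for all $N\ge0$ and homogeneous $x_1,\ldots,x_N$: $\sum_{i=0}^N\sum_{\sigma\in Sh(i,N-i)}\epsilon(\sigma)\,l_{N-i+1}(l_i(x_{\sigma(1)},\ldots,x_{\sigma(i)}),x_{\sigma(i+1)},\ldots,x_{\sigma(N)})=0$, where $Sh(i,N-i)$ is the set of $(i,N-i)$-shuffles. A Maurer-Cartan element is $\alpha\in\mathcal G_0$ with $l_0+\sum_{k\ge1}\frac1{k!}l_k(\alpha,\ldots,\alpha)=0$. *)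

(* Defs.v *)
(* The classical axioms of boolp serve only to make the function spaces
   seq E -> F, and the submodules of cochains below, lmodTypes. *)
From HB Require Import structures.
From mathcomp Require Import all_boot all_order all_algebra all_fingroup.
From mathcomp Require Import sesquilinear.
From mathcomp Require Import boolp functions zify.

Set Implicit Arguments.
Unset Strict Implicit.
Unset Printing Implicit Defensive.

Import GRing.Theory.
Local Open Scope ring_scope.

(* A family of k-ary maps, k >= 0, is encoded as a single function on lists,
   whose restriction to the lists of length k is the k-ary map; this predicate
   says that each member of the family is linear in each argument. *)
Definition multilinear (K : fieldType) (E F : lmodType K) (f : seq E -> F) :=
  forall (s1 s2 : seq E) (a : K) (u v : E),
    f (s1 ++ (a *: u + v) :: s2) = a *: f (s1 ++ u :: s2) + f (s1 ++ v :: s2).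

Section Cochains.
Variables (K : fieldType) (E F : lmodType K).

(* The direct sum over n >= 0 of Hom(E^{(x) n+1}, F): there is no component on
   the empty list, and only finitely many components are nonzero. *)
Definition is_cochain (f : seq E -> F) : Prop :=
  [/\ multilinear f, f [::] = 0 &
      exists n : nat, forall s, (n < size s)%N -> f s = 0].

Definition cochain_pred : {pred (seq E -> F)} := fun f => `[< is_cochain f >].

Record cochain := Cochain { cochain_val :> seq E -> F;
                            cochain_valP : cochain_val \in cochain_pred }.

HB.instance Definition _ := [isSub for cochain_val].
HB.instance Definition _ := [Choice of cochain by <:].

Lemma cochain_submod_closed : submod_closed cochain_pred.
Proof.
split; first by apply/asboolP; split=> [s1 s2 a u v||];
  [rewrite [RHS]addr0 scaler0 | | exists 0%N].
move=> a f g /asboolP[fl f0 [m fm]] /asboolP[gl g0 [n gn]].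
apply/asboolP; split.
- move=> s1 s2 b u v; rewrite -[LHS]/(a *: f _ + g _) fl gl.
  rewrite -[X in _ = b *: X + _]/(a *: f _ + g _).
  rewrite -[X in _ = _ + X]/(a *: f _ + g _).
  by rewrite !scalerDr !scalerA (mulrC a b) addrACA.
- by rewrite -[LHS]/(a *: f _ + g _) f0 g0 scaler0 addr0.
- exists (m + n)%N => s lt_s; rewrite -[LHS]/(a *: f _ + g _) fm ?gn.
  + by rewrite scaler0 addr0.
  + by apply: leq_ltn_trans lt_s; apply: leq_addl.
  + by apply: leq_ltn_trans lt_s; apply: leq_addr.
Qed.

HB.instance Definition _ :=
  GRing.isSubmodClosed.Build _ _ cochain_pred cochain_submod_closed.
HB.instance Definition _ := [SubChoice_isSubLmodule of cochain by <:].

Lemma cochainP (f : cochain) : is_cochain f.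
Proof. exact/asboolP/cochain_valP. Qed.

Definition mk_cochain (f : seq E -> F) (fP : is_cochain f) : cochain :=
  Cochain (asboolT fP).

(* Degree n means n+1 inputs; for n < 0 this leaves only the zero cochain. *)
Definition cochain_deg (n : int) (f : cochain) : Prop :=
  forall s : seq E, (size s)%:Z != n + 1 -> f s = 0.

Definition linear_fun1 (h : E -> F) (s : seq E) : F :=
  if s is [:: a] then h a else 0.

Lemma linear_fun1P (h : {linear E -> F}) : is_cochain (linear_fun1 h).
Proof.
split=> //; last by exists 1%N; case=> [|? []].
case=> [|x [|y s1]] s2 a u v /=; last by rewrite scaler0 addr0.
- by case: s2 => [|? ?]; rewrite ?linearP ?scaler0 ?addr0.
- by rewrite scaler0 addr0.
Qed.

Definition cochain1 (h : {linear E -> F}) : cochain :=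
  mk_cochain (linear_fun1P h).

Definition bilinear_fun2 (h : E -> E -> F) (s : seq E) : F :=
  if s is [:: a; b] then h a b else 0.

Lemma bilinear_fun2P (h : {bilinear E -> E -> F}) :
  is_cochain (bilinear_fun2 h).
Proof.
split=> //; last by exists 2%N; case=> [|? [|? []]].
case=> [|x [|y s1]] s2 a u v /=.
- by case: s2 => [|? []] *; rewrite ?linearPl ?scaler0 ?addr0.
- by case: s2 => [|? ?] *; rewrite ?linearPr ?scaler0 ?addr0.
- by case: s1 => *; rewrite scaler0 addr0.
Qed.

Definition cochain2 (h : {bilinear E -> E -> F}) : cochain :=
  mk_cochain (bilinear_fun2P h).

End Cochains.

Section Gerstenhaber.
Variables (K : fieldType) (E : lmodType K).
Implicit Types f g : seq E -> E.

Definition insertion f g (i n : nat) (s : seq E) : E :=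
  f (take i s ++ g (take n (drop i s)) :: drop (i + n) s).

(* f_p <> g_q, evaluated on a list of length p + q + 1, where f_p is the
   component of f with p + 1 inputs and g_q that of g with q + 1 inputs. *)
Definition diamond f g (p q : nat) (s : seq E) : E :=
  \sum_(i < p.+1) (-1) ^+ (i * q) *: insertion f g i q.+1 s.

(* The bilinear extension of the bracket to nonhomogeneous elements:
   [f, g] is the sum over p, q of f_p <> g_q - (-1)^{p q} g_q <> f_p, and on a
   list s only the terms with p + q + 1 = size s contribute. *)
Definition gerstenhaber_fun f g (s : seq E) : E :=
  \sum_(p < size s) let q := (size s - p.+1)%N in
    (diamond f g p q s - (-1) ^+ (p * q) *: diamond g f q p s).

Lemma insertion_multilinear f g i n :
  multilinear f -> multilinear g -> multilinear (insertion f g i n).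
Proof.
move=> fl gl s1 s2 a u v; rewrite /insertion.
have [lt1|le1] := ltnP (size s1) i.
  have tE w : take i (s1 ++ w :: s2) = s1 ++ w :: take (i - size s1).-1 s2.
    by rewrite take_cat ltnNge ltnW //= -{1}(prednK (n := i - size s1)%N)
      ?subn_gt0.
  have dE k w : (i <= k)%N ->
      drop k (s1 ++ w :: s2) = drop (k - size s1).-1 s2.
    move=> le_ik; have lt_k := leq_trans lt1 le_ik.
    by rewrite drop_cat ltnNge ltnW //= -{1}(prednK (n := k - size s1)%N)
      ?subn_gt0.
  by rewrite !tE !dE ?leq_addr // -!catA /= fl.
have tE w : take i (s1 ++ w :: s2) = take i s1 by rewrite takel_cat.
have dE w : drop i (s1 ++ w :: s2) = drop i s1 ++ w :: s2.
  rewrite drop_cat; case: ltnP => // ge1.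
  by have -> : i = size s1; [apply/eqP; rewrite eqn_leq le1 | rewrite subnn drop0 drop_size].
rewrite !tE !dE; have [lt2|le2] := ltnP (size (drop i s1)) n.
  have tE2 w : take n (drop i s1 ++ w :: s2) =
      drop i s1 ++ w :: take (n - size (drop i s1)).-1 s2.
    by rewrite take_cat ltnNge ltnW //=
      -{1}(prednK (n := n - size (drop i s1))%N) ?subn_gt0.
  have dE2 w : drop (i + n) (s1 ++ w :: s2) =
      drop (i + n - size s1).-1 s2.
    have lt : (size s1 < i + n)%N by rewrite -ltn_subLR // -size_drop.
    by rewrite drop_cat ltnNge ltnW //= -{1}(prednK (n := i + n - size s1)%N)
      ?subn_gt0.
  by rewrite !tE2 !dE2 gl fl.
have tE2 w : take n (drop i s1 ++ w :: s2) = take n (drop i s1).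
  by rewrite takel_cat.
have dE2 w : drop (i + n) (s1 ++ w :: s2) = drop (i + n) s1 ++ w :: s2.
  rewrite addnC -!drop_drop dE drop_cat; case: ltnP => // ge2.
  have -> : n = size (drop i s1) by apply/eqP; rewrite eqn_leq le2.
  by rewrite subnn drop0 drop_size.
rewrite !tE2 !dE2.
by have := fl (take i s1 ++ g (take n (drop i s1)) :: drop (i + n) s1) s2 a u v;
  rewrite -!catA.
Qed.

Lemma diamond_multilinear f g p q :
  multilinear f -> multilinear g -> multilinear (diamond f g p q).
Proof.
move=> fl gl s1 s2 a u v; rewrite /diamond scaler_sumr -big_split.
apply: eq_bigr => i _; rewrite insertion_multilinear //= scalerDr.
by rewrite !scalerA (mulrC a).
Qed.

Lemma multilinear0 f s1 s2 : multilinear f -> f (s1 ++ 0 :: s2) = 0.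
Proof.
move=> fl; have := fl s1 s2 (-1) 0 0; rewrite scaler0 addr0 => ->.
by rewrite scaleN1r addNr.
Qed.

Lemma diamond_eq0 f g p q m n s :
  multilinear f ->
  (forall t, (m < size t)%N -> f t = 0) ->
  (forall t, (n < size t)%N -> g t = 0) ->
  size s = (p + q).+1 -> (m + n < size s)%N -> diamond f g p q s = 0.
Proof.
move=> fl fm gn size_s lt_s; apply: big1 => -[i le_i] _ /=.
rewrite /insertion; have [lt_n|le_n] := ltnP n q.+1.
  rewrite gn ?(multilinear0 _ _ fl) ?scaler0 // size_take size_drop.
  by case: ifP => _; lia.
rewrite fm ?scaler0 // size_cat /= size_take size_drop.
by case: ifP => _; lia.
Qed.

Lemma gerstenhaberP (f g : cochain E E) : is_cochain (gerstenhaber_fun f g).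
Proof.
have [fl _ [m fm]] := cochainP f; have [gl _ [n gn]] := cochainP g.
split; last first.
- exists (m + n)%N => s lt_s; apply: big1 => -[p lt_p] _ /=.
  have size_s : size s = (p + (size s - p.+1)).+1 by lia.
  rewrite (diamond_eq0 fl fm gn) // (diamond_eq0 gl gn fm) ?scaler0 ?subr0 //.
  + by rewrite addnC.
  + by rewrite addnC.
- by rewrite /gerstenhaber_fun big_ord0.
move=> s1 s2 a u v.
have size_w w : size (s1 ++ w :: s2) = (size s1 + size s2).+1.
  by rewrite size_cat /= addnS.
rewrite /gerstenhaber_fun !size_w scaler_sumr -big_split.
apply: eq_bigr => p _ /=; rewrite !diamond_multilinear // scalerDr scalerBr.
by rewrite !scalerA (mulrC a) opprD addrACA.
Qed.

Definition gerstenhaber (f g : cochain E E) : cochain E E :=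
  mk_cochain (gerstenhaberP f g).

End Gerstenhaber.

Section ExtensionByZero.
Variables (K : fieldType) (A B : lmodType K).

Definition extension_fun (f : seq A -> B) (s : seq (A * B)) : A * B :=
  (0, f [seq u.1 | u <- s]).

Lemma extensionP (f : cochain A B) : is_cochain (extension_fun f).
Proof.
have [fl f0 [n fn]] := cochainP f; split.
- move=> s1 s2 a u v; rewrite /extension_fun !map_cat /= fl.
  by apply/eqP; rewrite xpair_eqE /= scaler0 addr0 !eqxx.
- by rewrite /extension_fun /= f0.
- by exists n => s lt_s; rewrite /extension_fun fn ?size_map.
Qed.

Definition extension (f : cochain A B) : cochain (A * B)%type (A * B)%type :=
  mk_cochain (extensionP f).

Lemma extension_inj : injective extension.
Proof.
move=> f g /(congr1 val) eq_fg; apply: val_inj; apply/funext => s.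
have /(congr1 snd) := congr1 (fun h => h [seq (a, 0) | a <- s]) eq_fg.
by rewrite /= -map_comp map_id.
Qed.

End ExtensionByZero.

Section CurvedLinfty.
Variables (K : fieldType) (V : lmodType K).

(* gr n is the homogeneous component of degree n; V is their direct sum. *)
Record is_grading (gr : int -> V -> Prop) : Prop := {
  grading0 : forall n, gr n 0;
  gradingP : forall n (a : K) u v, gr n u -> gr n v -> gr n (a *: u + v);
  grading_span : forall v, exists (r : seq int) (u : int -> V),
    (forall n, gr n (u n)) /\ v = \sum_(n <- r) u n;
  grading_free : forall (r : seq int) (u : int -> V),
    uniq r -> (forall n, gr n (u n)) -> \sum_(n <- r) u n = 0 ->
    forall n, n \in r -> u n = 0
}.

(* x_1 ... x_k = koszul_sign d s * x_{s 1} ... x_{s k} in the free graded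
   commutative algebra, where x_i has degree d i. *)
Definition koszul_sign (k : nat) (d : 'I_k -> int) (s : 'S_k) : K :=
  \prod_(i < k) \prod_(j < k | (i < j)%N && (s j < s i)%N)
    (-1) ^ (d (s i) * d (s j)).

Definition shuffle (k i : nat) (s : 'S_k) : bool :=
  [forall a : 'I_k, forall b : 'I_k,
    (a < b)%N && ((b < i)%N || (i <= a)%N) ==> (s a < s b)%N].

(* l [:: x_1; ...; x_k] stands for l_k(x_1, ..., x_k). *)
Record curved_Linfty (gr : int -> V -> Prop) (l : seq V -> V) : Prop := {
  Linfty_grading : is_grading gr;
  Linfty_multilinear : multilinear l;
  Linfty_degree : forall (k : nat) (d : 'I_k -> int) (x : 'I_k -> V),
    (forall i, gr (d i) (x i)) ->
    gr (1 + \sum_(i < k) d i) (l [seq x i | i : 'I_k]);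
  Linfty_symmetric : forall (k : nat) (d : 'I_k -> int) (x : 'I_k -> V)
    (s : 'S_k), (forall i, gr (d i) (x i)) ->
    l [seq x i | i : 'I_k] = koszul_sign d s *: l [seq x (s i) | i : 'I_k];
  Linfty_relation : forall (N : nat) (d : 'I_N -> int) (x : 'I_N -> V),
    (forall i, gr (d i) (x i)) ->
    \sum_(i < N.+1) \sum_(s : 'S_N | shuffle i s)
      koszul_sign d s *:
        (let xs := [seq x (s j) | j : 'I_N] in
         l (l (take i xs) :: drop i xs)) = 0
}.

(* The infinite sum over k is read as a finite one: its terms vanish from some
   rank n on, and the remaining ones add up to zero. *)
Definition maurer_cartan (gr : int -> V -> Prop) (l : seq V -> V) (x : V) :=
  gr 0 x /\
  exists n : nat, (forall k, (n <= k)%N -> l (nseq k x) = 0) /\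
    l [::] + \sum_(1 <= k < n) (k`!%:R : K)^-1 *: l (nseq k x) = 0.

End CurvedLinfty.

Section QuasiTwilled.
Variables (K : fieldType) (A B : lmodType K).

(* rtri, ltri, rharp, lharp are the maps written with a right triangle, left
   triangle, right harpoon, left harpoon. *)
Record quasi_twilled := QuasiTwilled {
  mu : {bilinear A -> A -> A};
  nu : {bilinear B -> B -> B};
  rtri : {bilinear A -> B -> B};
  ltri : {bilinear B -> A -> B};
  rharp : {bilinear B -> A -> A};
  lharp : {bilinear A -> B -> A};
  theta : {bilinear A -> A -> B};
  quasi_twilled_mulA : associative (fun u v : A * B =>
    (mu u.1 v.1 + lharp u.1 v.2 + rharp u.2 v.1,
     nu u.2 v.2 + rtri u.1 v.2 + ltri u.2 v.1 + theta u.1 v.1))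
}.

Variable Q : quasi_twilled.

Definition mu_tri (u v : A * B) : A * B :=
  (mu Q u.1 v.1, rtri Q u.1 v.2 + ltri Q u.2 v.1).

Definition nu_harp (u v : A * B) : A * B :=
  (lharp Q u.1 v.2 + rharp Q u.2 v.1, nu Q u.2 v.2).

Lemma mu_tri_bilinear : bilinear_for
  (GRing.Scale.Law.clone _ _ *:%R _) (GRing.Scale.Law.clone _ _ *:%R _) mu_tri.
Proof.
split=> w a u v; rewrite /mu_tri /= ?(linearPl, linearPr);
  by congr pair; rewrite /= scalerDr addrACA.
Qed.

HB.instance Definition _ := bilinear_isBilinear.Build K
  (A * B)%type (A * B)%type (A * B)%type
  (GRing.Scale.Law.clone _ _ *:%R _) (GRing.Scale.Law.clone _ _ *:%R _)
  mu_tri mu_tri_bilinear.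

Lemma nu_harp_bilinear : bilinear_for
  (GRing.Scale.Law.clone _ _ *:%R _) (GRing.Scale.Law.clone _ _ *:%R _) nu_harp.
Proof.
split=> w a u v; rewrite /nu_harp /= ?(linearPl, linearPr);
  by congr pair; rewrite /= scalerDr addrACA.
Qed.

HB.instance Definition _ := bilinear_isBilinear.Build K
  (A * B)%type (A * B)%type (A * B)%type
  (GRing.Scale.Law.clone _ _ *:%R _) (GRing.Scale.Law.clone _ _ *:%R _)
  nu_harp nu_harp_bilinear.

Definition strong_deformation_map (D : {linear A -> B}) : Prop :=
  forall a b : A,
    D (mu Q a b + lharp Q a (D b) + rharp Q (D a) b) =
    nu Q (D a) (D b) + rtri Q a (D b) + ltri Q (D a) b + theta Q a b.

End QuasiTwilled.

(* Main.v *)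
From HB Require Import structures.
Require Import Defs.
From mathcomp Require Import all_boot all_order all_algebra all_fingroup.
From mathcomp Require Import sesquilinear boolp functions zify.
Import GRing.Theory.

(** The brackets are derived brackets in the Gerstenhaber Lie algebra of
    E = A + B, and the theorem comes from a grading of that Lie algebra.

    Give a cochain on E the weight w when its values on lists of elements of A
    and of B have (number of outputs in B) - (number of inputs in B) = w.  The
    bracket adds weights (weight_gerstenhaber).  A nonzero cochain has weight at
    most 1, and weight 1 forces all inputs to lie in A and the output in B.  So
    the cochains from A to B, extended by zero, are exactly the cochains of
    weight 1 (restrictionK), and the bracket of two of them, of weight 2, is
    zero (weight_eq0).  The maps m = mu_tri, n = nu_harp and theta have weights
    0, -1 and 1, so that l_1 = [m, -] and l_2 = [[n, -], -] preserve weight 1.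

    The multiplication of E is m + n + theta, and its associativity says that
    [m + n + theta, m + n + theta] = 0.  The components of the different weights
    vanish separately (quasi_twilled_components):
      [n, n] = 0,  [m, n] = 0,  [m, m] = - 2 [n, theta],  [m, theta] = 0.
    Since l_k = 0 for k >= 3, the relation of the curved L-infinity algebra is
    nontrivial only for at most three arguments.  With no argument it is
    [m, theta] = 0; with one, two and three arguments it follows, by the graded
    Jacobi identity, from the third, the second and the first of these
    equations.  The graded symmetry of l_2 is the Jacobi identity for n and two
    commuting elements.

    The Jacobi identity itself (gerstenhaber_jacobi) follows from the pre-Lie
    identity of the diamond product (circ_pre_lie), which is proved by induction
    on the list of arguments, by isolating the insertions that involve its first
    element.

    Finally, on a pair (a, b) of elements of A the element
    theta + l_1(D) + l_2(D, D) / 2 is the difference of the two sides of the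
    equation of a strong deformation map. *)

Set Implicit Arguments.
Unset Strict Implicit.
Unset Printing Implicit Defensive.
Local Open Scope ring_scope.

(** * Equations in abelian groups *)

(** Formal sums and opposites of atoms, numbered by natural numbers. *)
Inductive abel_term : Type :=
| AbelAtom of nat
| AbelZero
| AbelAdd of abel_term & abel_term
| AbelOpp of abel_term.

Fixpoint abel_eval (V : zmodType) (env : seq V) (e : abel_term) : V :=
  match e with
  | AbelAtom i => nth 0 env i
  | AbelZero => 0
  | AbelAdd e1 e2 => abel_eval env e1 + abel_eval env e2
  | AbelOpp e1 => - abel_eval env e1
  end.

Fixpoint abel_coef (e : abel_term) (i : nat) : int :=
  match e with
  | AbelAtom j => (i == j)%:Z
  | AbelZero => 0
  | AbelAdd e1 e2 => abel_coef e1 i + abel_coef e2 i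
  | AbelOpp e1 => - abel_coef e1 i
  end.

Lemma abel_evalE (V : zmodType) (env : seq V) (e : abel_term) :
  abel_eval env e = \sum_(i < size env) nth 0 env i *~ abel_coef e i.
Proof.
elim: e => [j||e1 IH1 e2 IH2|e1 IH1] /=.
- have [lt_j|le_j] := ltnP j (size env).
    rewrite (bigD1 (Ordinal lt_j)) //= eqxx big1 ?addr0 // => i.
    by rewrite -val_eqE /= => /negPf ->.
  rewrite nth_default // big1 // => i _.
  by rewrite ltn_eqF // (leq_trans (ltn_ord i)).
- by rewrite big1.
- by rewrite IH1 IH2 -big_split; apply: eq_bigr => i _; rewrite mulrzDr.
- by rewrite IH1 -sumrN; apply: eq_bigr => i _; rewrite mulrNz.
Qed.

Lemma abel_correct (V : zmodType) (env : seq V) (e1 e2 : abel_term) :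
  all (fun i => abel_coef e1 i == abel_coef e2 i) (iota 0 (size env)) ->
  abel_eval env e1 = abel_eval env e2.
Proof.
move=> /allP eq12; rewrite !abel_evalE; apply: eq_bigr => i _.
by rewrite (eqP (eq12 i _)) // mem_iota add0n ltn_ord.
Qed.

(* Atoms are compared up to conversion, as the same operation may occur through
   different structures. *)
Ltac abel_index x env :=
  match env with
  | ?y :: _ => let _ := match goal with _ => unify x y end in constr:(O)
  | _ :: ?env' => let i := abel_index x env' in constr:(S i)
  end.
Ltac abel_insert x env :=
  match env with
  | _ => let i := abel_index x env in env
  | _ => constr:(x :: env)
  end.
Ltac abel_atoms env t :=
  lazymatch t with
  | ?a + ?b => let env' := abel_atoms env a in abel_atoms env' b
  | - ?a => abel_atoms env a
  | 0 => env
  | _ => abel_insert t env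
  end.
Ltac abel_reify env t :=
  lazymatch t with
  | ?a + ?b => let a' := abel_reify env a in let b' := abel_reify env b in
               constr:(AbelAdd a' b')
  | - ?a => let a' := abel_reify env a in constr:(AbelOpp a')
  | 0 => constr:(AbelZero)
  | _ => let i := abel_index t env in constr:(AbelAtom i)
  end.

(** Decides an equation between integral combinations of atoms in an abelian
    group by comparing the coefficients of each atom. *)
Ltac abel :=
  lazymatch goal with
  | |- @eq ?V ?a ?b =>
    let env := abel_atoms (@nil V) a in
    let env := abel_atoms env b in
    let a' := abel_reify env a in
    let b' := abel_reify env b in
    exact (@abel_correct _ env a' b' isT)
  end.

(** * Partial composition and the pre-Lie identity *)

Lemma multilinear_at0 (K : fieldType) (E F : lmodType K) (f : seq E -> F)
    s1 s2 :
  multilinear f -> f (s1 ++ 0 :: s2) = 0.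
Proof.
by move=> fl; have := fl s1 s2 (-1) 0 0; rewrite scaler0 addr0 scaleN1r addNr.
Qed.

Section PreLie.
Variables (K : fieldType) (E : lmodType K).
Implicit Types f g h : seq E -> E.

Lemma signr_if n : (-1) ^+ n = (if odd n then -1 else 1) :> K.
Proof. by rewrite -signr_odd; case: odd. Qed.

(** The diamond product f <> g for g with q + 1 inputs: the sum over all
    positions i of (-1)^{i q} times the insertion of g at i.  The list of
    arguments determines the number of inputs of f, and the sum is empty on a
    list with at most q elements. *)
Definition circ f (q : nat) g (s : seq E) : E :=
  \sum_(i < size s - q) (-1) ^+ (i * q) *: insertion f g i q.+1 s.

(** All components of g other than the one with q + 1 inputs are zero. *)
Definition homog (F : lmodType K) (q : nat) (g : seq E -> F) :=
  forall s, size s != q.+1 -> g s = 0.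

Lemma circ_nil f q g : circ f q g [::] = 0.
Proof. by rewrite /circ sub0n big_ord0. Qed.

Lemma eq_circ f f' q g : f =1 f' -> circ f q g =1 circ f' q g.
Proof. by move=> ff' s; apply: eq_bigr => i _; rewrite /insertion ff'. Qed.

Lemma circ_linearl a f f' q g s :
  circ (fun t => a *: f t + f' t) q g s = a *: circ f q g s + circ f' q g s.
Proof.
rewrite /circ scaler_sumr -big_split; apply: eq_bigr => i _ /=.
by rewrite scalerDr !scalerA mulrC.
Qed.

Lemma circ_linearr f a q g g' s : multilinear f ->
  circ f q (fun t => a *: g t + g' t) s = a *: circ f q g s + circ f q g' s.
Proof.
move=> fl; rewrite /circ scaler_sumr -big_split; apply: eq_bigr => i _ /=.
by rewrite /insertion fl scalerDr !scalerA mulrC.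
Qed.

(** The insertion at the first position, and the others. *)
Lemma circ_cons_guarded f q g x s : circ f q g (x :: s) =
  (if (q <= size s)%N then f (g (x :: take q s) :: drop q s) else 0) +
  (-1) ^+ q *: circ (f \o cons x) q g s.
Proof.
rewrite /circ /=; have [le_q|lt_q] := leqP q (size s).
  rewrite subSn // big_ord_recl /= mul0n expr0 scale1r /insertion /=.
  congr (_ + _); rewrite scaler_sumr; apply: eq_bigr => i _.
  by rewrite scalerA -exprD /bump /= add1n mulSn.
rewrite (_ : _ - _ = 0)%N; last by lia.
by rewrite (_ : size s - q = 0)%N ?big_ord0 ?scaler0 ?addr0 //; lia.
Qed.

Lemma circ_multilinear f q g :
  multilinear f -> multilinear g -> multilinear (circ f q g).
Proof.
move=> fl gl s1 s2 a u v.
have size_w w : size (s1 ++ w :: s2) = (size s1 + size s2).+1.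
  by rewrite size_cat /= addnS.
rewrite /circ !size_w scaler_sumr -big_split; apply: eq_bigr => i _.
by rewrite insertion_multilinear //= scalerDr !scalerA mulrC.
Qed.

Lemma homog_circ f p g q :
  multilinear f -> homog p f -> homog q g -> homog (p + q) (circ f q g).
Proof.
move=> fl fp gq s ns; rewrite /circ; apply: big1 => -[i lti] _.
rewrite /insertion /= fp ?scaler0 //.
by rewrite size_cat /= size_take size_drop; case: ifP; lia.
Qed.

Lemma multilinear_hd0 f s : multilinear f -> f (0 :: s) = 0.
Proof. by move=> fl; apply: (multilinear_at0 [::] s fl). Qed.

Lemma circ_cons f q g x s : multilinear f -> homog q g ->
  circ f q g (x :: s) =
  f (g (x :: take q s) :: drop q s) + (-1) ^+ q *: circ (f \o cons x) q g s.
Proof.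
move=> fl gq; rewrite circ_cons_guarded; case: leqP => // lt_q.
by rewrite gq ?multilinear_hd0 //= size_take; case: ifP; lia.
Qed.

(** Insertions of g into a list read as a prefix of length p followed by a
    suffix: g is inserted either in the prefix, which then takes p + q elements
    of the list, or in the suffix. *)
Lemma circ_take_drop (F : seq E -> seq E -> E) p q g s :
  circ (fun t => F (take p t) (drop p t)) q g s =
  circ (F^~ (drop (p + q) s)) q g (take (p + q) s) +
  (-1) ^+ (p * q) *: circ (F (take p s)) q g (drop p s).
Proof.
elim: p F s => [|p IHp] F s.
  rewrite mul0n expr0 scale1r add0n take0 drop0.
  rewrite [X in X + _](_ : _ = 0) ?add0r; last first.
    rewrite /circ size_take (_ : _ - _ = 0)%N ?big_ord0 //; case: ifP; lia.
  by apply: eq_circ => t; rewrite take0 drop0.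
case: s => [|x s]; first by rewrite /= !circ_nil scaler0 addr0.
rewrite circ_cons_guarded addSn /= circ_cons_guarded -addrA; congr (_ + _).
  rewrite size_take take_takel ?leq_addl // take_drop drop_drop.
  have [lt_s|//] := ltnP (p + q) (size s).
  by rewrite leq_addl (leq_trans _ (ltnW lt_s)) ?leq_addl.
rewrite mulSn exprD -scalerA -scalerDr; congr (_ *: _).
exact: (IHp (fun t => F (x :: t))).
Qed.

Lemma multilinear_cons f x : multilinear f -> multilinear (f \o cons x).
Proof. by move=> fl s1 s2 a u v; rewrite /= -!cat_cons fl. Qed.

Lemma multilinear_hd_sum f (I : finType) (F : I -> E) s : multilinear f ->
  f ((\sum_i F i) :: s) = \sum_i f (F i :: s).
Proof.
move=> fl; apply: (big_morph (fun u => f (u :: s)));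
  last exact: multilinear_hd0.
by move=> u v; have := fl [::] s 1 u v; rewrite /= !scale1r.
Qed.

Lemma multilinear_hdZ f a u s :
  multilinear f -> f (a *: u :: s) = a *: f (u :: s).
Proof.
move=> fl; have := fl [::] s a u 0.
by rewrite /= !addr0 multilinear_hd0 // addr0.
Qed.

Lemma multilinear_hdD f u v s :
  multilinear f -> f (u + v :: s) = f (u :: s) + f (v :: s).
Proof.
by move=> fl; have := fl [::] s 1 u v; rewrite /= !scale1r.
Qed.

(** The associator on x :: s.  The terms with h nested in g and x among their
    arguments cancel; in the remaining ones x is an argument of h, of g, or of
    neither. *)
Lemma associator_cons f p g q h x s :
  multilinear f -> homog p g -> homog q h -> homog (p + q) (circ g q h) ->
  multilinear g ->
  circ (circ f p g) q h (x :: s) - circ f (p + q) (circ g q h) (x :: s) =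
  (-1) ^+ p *: circ (f \o cons (h (x :: take q s))) p g (drop q s)
  + (-1) ^+ (q + p * q) *: circ (f \o cons (g (x :: take p s))) q h (drop p s)
  + (-1) ^+ (p + q) *: (circ (circ (f \o cons x) p g) q h s
                        - circ (f \o cons x) (p + q) (circ g q h) s).
Proof.
move=> fl gp hq ghpq gl.
have fgl : multilinear (circ f p g) by apply: circ_multilinear.
rewrite (circ_cons x s fgl hq) (circ_cons x s fl ghpq).
rewrite (circ_cons _ _ fl gp) (circ_cons _ _ gl hq).
rewrite take_takel ?leq_addl // take_drop.
have -> : circ (circ f p g \o cons x) q h s =
    circ (fun t => f (g (x :: take p t) :: drop p t)) q h s
    + (-1) ^+ p *: circ (circ (f \o cons x) p g) q h s.
  rewrite addrC -circ_linearl; apply: eq_circ => t /=.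
  by rewrite circ_cons // addrC.
rewrite (circ_take_drop (fun t u => f (g (x :: t) :: u))).
rewrite multilinear_hdD // multilinear_hdZ //.
have -> : f (circ (g \o cons x) q h (take (p + q) s) :: drop (p + q) s) =
    circ (fun t => f (g (x :: t) :: drop (p + q) s)) q h (take (p + q) s).
  rewrite /circ multilinear_hd_sum //; apply: eq_bigr => i _.
  by rewrite multilinear_hdZ.
rewrite !scalerDr !scalerA -!exprD scalerN addnC drop_drop (addnC p q).
abel.
Qed.

(** The right pre-Lie identity: up to sign, the associator of the partial
    compositions is symmetric in its last two arguments. *)
Lemma circ_pre_lie f p g q h s :
  multilinear f -> multilinear g -> multilinear h -> homog p g -> homog q h ->
  circ (circ f p g) q h s - circ f (p + q) (circ g q h) s =
  (-1) ^+ (p * q) *: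
    (circ (circ f q h) p g s - circ f (p + q) (circ h p g) s).
Proof.
move=> fl gl hl gp hq; elim: s f fl => [|x s IHs] f fl.
  by rewrite !circ_nil subr0 scaler0.
have ghpq := homog_circ gl gp hq.
have hgqp : homog (q + p) (circ h p g) by apply: homog_circ.
have IH := IHs _ (multilinear_cons x fl).
rewrite associator_cons // IH [in RHS](addnC p q) associator_cons //.
rewrite (addnC q p) !scalerDr !scalerA -!exprD.
rewrite !(signr_if, oddD, oddM).
by case: (odd p); case: (odd q); rewrite /= ?scale1r ?scaleN1r; abel.
Qed.

End PreLie.

(** * The Gerstenhaber Lie algebra *)

Section CochainModule.
Variables (K : fieldType) (E F : lmodType K).
Implicit Types f g : cochain E F.

Lemma cochain_ext f g : f =1 g -> f = g.
Proof. by move=> fg; apply/val_inj/funext. Qed.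

Lemma cochainD f g s : (f + g) s = f s + g s.
Proof. by []. Qed.
Lemma cochainN f s : (- f) s = - f s.
Proof. by []. Qed.
Lemma cochainZ a f s : (a *: f) s = a *: f s.
Proof. by []. Qed.
Lemma cochain0 s : (0 : cochain E F) s = 0.
Proof. by []. Qed.
Lemma cochain_sum (I : Type) (r : seq I) (P : pred I) (f : I -> cochain E F) s :
  (\sum_(i <- r | P i) f i) s = \sum_(i <- r | P i) f i s.
Proof. by elim/big_rec2: _ => // i u v _ <-. Qed.

Lemma cochain_multilinear f : multilinear f.
Proof. by case: (cochainP f). Qed.

Lemma cochain_deg0 n : cochain_deg n (0 : cochain E F).
Proof. by []. Qed.

(** A homogeneous cochain is zero unless its degree is a natural number. *)
Lemma cochain_deg_homog n f :
  cochain_deg n f -> f = 0 \/ exists2 p : nat, n = p%:Z & homog p f.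
Proof.
case: n => [p|p] fn;
  [right; exists p => // s ns | left; apply: cochain_ext => s].
  by apply: fn; move: ns; lia.
case: s => [|x s]; first by case: (cochainP f).
by rewrite fn //; rewrite /=; lia.
Qed.

Lemma homog_cochain_deg (p : nat) f : homog p f -> cochain_deg p f.
Proof. by move=> fp s ns; apply: fp; move: ns; lia. Qed.

End CochainModule.

Section Bracket.
Variables (K : fieldType) (E : lmodType K).
Implicit Types f g h : cochain E E.

Lemma diamond_linearl (a : K) (f f' g : seq E -> E) p q s :
  diamond (fun t => a *: f t + f' t) g p q s =
  a *: diamond f g p q s + diamond f' g p q s.
Proof.
rewrite /diamond scaler_sumr -big_split; apply: eq_bigr => i _ /=.
by rewrite /insertion scalerDr !scalerA mulrC.
Qed.

Lemma diamond_linearr (a : K) (f g g' : seq E -> E) p q s : multilinear f ->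
  diamond f (fun t => a *: g t + g' t) p q s =
  a *: diamond f g p q s + diamond f g' p q s.
Proof.
move=> fl; rewrite /diamond scaler_sumr -big_split; apply: eq_bigr => i _ /=.
by rewrite /insertion fl scalerDr !scalerA mulrC.
Qed.

Lemma gerstenhaber_is_bilinear : bilinear_for
  (GRing.Scale.Law.clone _ _ *:%R _) (GRing.Scale.Law.clone _ _ *:%R _)
  (@gerstenhaber K E).
Proof.
split=> u a f g; apply: cochain_ext => s;
  rewrite cochainD cochainZ /= /gerstenhaber_fun scaler_sumr -big_split;
  apply: eq_bigr => p _ /=;
  rewrite (diamond_linearl a f g) (diamond_linearr a f g) //;
  try exact: cochain_multilinear;
  by rewrite scalerDr scalerBr !scalerA (mulrC a) opprD addrACA.
Qed.

HB.instance Definition _ := bilinear_isBilinear.Build K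
  (cochain E E) (cochain E E) (cochain E E)
  (GRing.Scale.Law.clone _ _ *:%R _) (GRing.Scale.Law.clone _ _ *:%R _)
  (@gerstenhaber K E) gerstenhaber_is_bilinear.

Lemma gerstenhaber0l f : gerstenhaber 0 f = 0.
Proof. exact: linear0l. Qed.
Lemma gerstenhaber0r f : gerstenhaber f 0 = 0.
Proof. exact: linear0r. Qed.
Lemma gerstenhaberDl f g h :
  gerstenhaber (f + g) h = gerstenhaber f h + gerstenhaber g h.
Proof. exact: linearDl. Qed.
Lemma gerstenhaberDr f g h :
  gerstenhaber f (g + h) = gerstenhaber f g + gerstenhaber f h.
Proof. exact: linearDr. Qed.
Lemma gerstenhaberNl f g : gerstenhaber (- f) g = - gerstenhaber f g.
Proof. exact: linearNl. Qed.
Lemma gerstenhaberZl a f g : gerstenhaber (a *: f) g = a *: gerstenhaber f g.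
Proof. exact: linearZl_LR. Qed.

Lemma diamond_homog0 (f g : seq E -> E) p q p' q' s :
  multilinear f -> homog p f -> homog q g -> size s = (p' + q').+1 ->
  (p' != p) || (q' != q) -> diamond f g p' q' s = 0.
Proof.
move=> fl fp gq size_s pq'; apply: big1 => -[i lti] _; rewrite /insertion /=.
have [eq_q|neq_q] := eqVneq q' q.
  rewrite fp ?scaler0 // size_cat /= size_take size_drop.
  by move: pq'; case: ifP; lia.
rewrite gq; first by rewrite multilinear_at0 ?scaler0.
by rewrite size_take size_drop; case: ifP; lia.
Qed.

(** On homogeneous cochains a single term of the bilinear extension of the
    bracket survives. *)
Lemma gerstenhaber_circ p q f g s : homog p f -> homog q g ->
  gerstenhaber f g s = circ f q g s - (-1) ^+ (p * q) *: circ g p f s.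
Proof.
move=> fp gq; rewrite /= /gerstenhaber_fun /=.
have fl := cochain_multilinear f; have gl := cochain_multilinear g.
have [size_s|size_s] := eqVneq (size s) (p + q).+1; last first.
  rewrite (homog_circ fl fp gq) // (homog_circ gl gq fp) 1?addnC //.
  rewrite scaler0 subr0; apply: big1 => -[p' ltp] _ /=.
  rewrite (diamond_homog0 fl fp gq) ?(diamond_homog0 gl gq fp) //; try lia.
  by rewrite scaler0 subr0.
have ltp : (p < size s)%N by rewrite size_s ltnS leq_addr.
rewrite (bigD1 (Ordinal ltp)) //= [X in _ + X]big1 ?addr0 => [|i]; last first.
  rewrite -val_eqE /= => nip; have := ltn_ord i => lti.
  rewrite (diamond_homog0 fl fp gq) ?(diamond_homog0 gl gq fp) //; try lia.
  by rewrite scaler0 subr0.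
rewrite /circ /diamond (_ : size s - p.+1 = q)%N; last by lia.
rewrite (_ : size s - q = p.+1)%N; last by lia.
by rewrite (_ : size s - p = q.+1)%N; last by lia.
Qed.

Lemma gerstenhaber_homog p q f g :
  homog p f -> homog q g -> homog (p + q) (gerstenhaber f g).
Proof.
have fl := cochain_multilinear f; have gl := cochain_multilinear g.
move=> fp gq s ns; rewrite (gerstenhaber_circ _ fp gq).
rewrite (homog_circ fl fp gq) // (homog_circ gl gq fp) 1?addnC //.
by rewrite scaler0 subr0.
Qed.

Lemma gerstenhaber_homogC p q f g : homog p f -> homog q g ->
  gerstenhaber f g = - ((-1) ^+ (p * q) *: gerstenhaber g f).
Proof.
move=> fp gq; apply: cochain_ext => s; rewrite cochainN cochainZ.
rewrite (gerstenhaber_circ _ fp gq) (gerstenhaber_circ _ gq fp) (mulnC q).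
rewrite !(signr_if, oddM).
by case: (_ && _); rewrite ?scale1r ?scaleN1r; abel.
Qed.

Lemma eq_circr (f g g' : seq E -> E) q : g =1 g' -> circ f q g =1 circ f q g'.
Proof. by move=> gg' s; apply: eq_bigr => i _; rewrite /insertion gg'. Qed.

(** Expanding the brackets leaves three graded differences of associators, which
    vanish by the pre-Lie identity. *)
Lemma gerstenhaber_homog_jacobi p q r f g h :
  homog p f -> homog q g -> homog r h ->
  gerstenhaber (gerstenhaber f g) h =
  gerstenhaber f (gerstenhaber g h)
  + (-1) ^+ (q * r) *: gerstenhaber (gerstenhaber f h) g.
Proof.
move=> fp gq hr; apply: cochain_ext => s; rewrite cochainD cochainZ.
have fl := cochain_multilinear f; have gl := cochain_multilinear g.
have hl := cochain_multilinear h.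
have brE (p1 q1 r1 : nat) (f1 g1 h1 : cochain E E) :
    homog p1 f1 -> homog q1 g1 -> homog r1 h1 ->
    gerstenhaber (gerstenhaber f1 g1) h1 s =
    circ (circ f1 q1 g1) r1 h1 s
    - (-1) ^+ (p1 * q1) *: circ (circ g1 p1 f1) r1 h1 s
    - (-1) ^+ ((p1 + q1) * r1) *: (circ h1 (p1 + q1) (circ f1 q1 g1) s
      - (-1) ^+ (p1 * q1) *: circ h1 (p1 + q1) (circ g1 p1 f1) s).
  move=> f1p g1q h1r; have h1l := cochain_multilinear h1.
  rewrite (gerstenhaber_circ _ (gerstenhaber_homog f1p g1q) h1r).
  rewrite (eq_circ r1 h1 (f' := fun t => - (-1) ^+ (p1 * q1) *: circ g1 p1 f1 t
      + circ f1 q1 g1 t)); last first.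
    by move=> t; rewrite (gerstenhaber_circ _ f1p g1q) scaleNr addrC.
  rewrite (eq_circr h1 (g' := fun t => - (-1) ^+ (p1 * q1) *: circ g1 p1 f1 t
      + circ f1 q1 g1 t)); last first.
    by move=> t; rewrite (gerstenhaber_circ _ f1p g1q) scaleNr addrC.
  rewrite circ_linearl circ_linearr // !scaleNr.
  by congr (_ - _ *: _); rewrite addrC.
rewrite (gerstenhaber_homogC fp (gerstenhaber_homog gq hr)) cochainN cochainZ.
rewrite (brE _ _ _ _ _ _ fp gq hr) (brE _ _ _ _ _ _ gq hr fp).
rewrite (brE _ _ _ _ _ _ fp hr gq).
have := circ_pre_lie s fl gl hl gq hr.
have := circ_pre_lie s gl fl hl fp hr.
have := circ_pre_lie s hl fl gl fp gq.
move=> /(canRL (subrK _))-> /(canRL (subrK _))-> /(canRL (subrK _))->.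
rewrite ?(addnC r q) ?(addnC r p) ?(addnC q p) !(signr_if, oddM, oddD).
by case: (odd p); case: (odd q); case: (odd r);
  rewrite /= ?scale1r ?scaleN1r; abel.
Qed.

End Bracket.

Section IntegerDegrees.
Variables (K : fieldType) (E : lmodType K).
Implicit Types f g h : cochain E E.

Lemma signz_if (n : int) : (-1) ^ n = (if odd (absz n) then -1 else 1) :> K.
Proof.
by case: n => n; rewrite -?exprnP ?NegzE -?exprnN ?signr_if ?abszN //=;
  case: (odd n); rewrite /= ?invrN invr1.
Qed.

Lemma odd_abszD (m n : int) :
  odd (absz (m + n)) = odd (absz m) (+) odd (absz n).
Proof. by lia. Qed.

Lemma odd_abszM (m n : int) : odd (absz (m * n)) = odd (absz m) && odd (absz n).
Proof. by rewrite abszM oddM. Qed.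

Lemma gerstenhaber_deg (p q : int) f g :
  cochain_deg p f -> cochain_deg q g -> cochain_deg (p + q) (gerstenhaber f g).
Proof.
move=> /cochain_deg_homog[->|[m -> fm]]; first by rewrite gerstenhaber0l.
move=> /cochain_deg_homog[->|[n -> gn]]; first by rewrite gerstenhaber0r.
exact/homog_cochain_deg/gerstenhaber_homog.
Qed.

Lemma gerstenhaberC (p q : int) f g : cochain_deg p f -> cochain_deg q g ->
  gerstenhaber f g = - ((-1) ^ (p * q) *: gerstenhaber g f).
Proof.
move=> /cochain_deg_homog[->|[m -> fm]].
  by rewrite gerstenhaber0l gerstenhaber0r scaler0 oppr0.
move=> /cochain_deg_homog[->|[n -> gn]].
  by rewrite gerstenhaber0l gerstenhaber0r scaler0 oppr0.
exact: gerstenhaber_homogC.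
Qed.

Lemma gerstenhaber_jacobi (p q r : int) f g h :
  cochain_deg p f -> cochain_deg q g -> cochain_deg r h ->
  gerstenhaber (gerstenhaber f g) h =
  gerstenhaber f (gerstenhaber g h)
  + (-1) ^ (q * r) *: gerstenhaber (gerstenhaber f h) g.
Proof.
move=> /cochain_deg_homog[->|[m _ fm]].
  by rewrite !gerstenhaber0l scaler0 addr0.
move=> /cochain_deg_homog[->|[n -> gn]].
  by rewrite !(gerstenhaber0l, gerstenhaber0r) scaler0 addr0.
move=> /cochain_deg_homog[->|[k -> hk]].
  by rewrite !(gerstenhaber0l, gerstenhaber0r) scaler0 addr0.
exact: (gerstenhaber_homog_jacobi fm gn hk).
Qed.

End IntegerDegrees.

(** * Weights *)

Section Weights.
Variables (K : fieldType) (A B : lmodType K).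
Local Notation E := (A * B)%type.
Implicit Types (F G : seq E -> E) (s : seq (A + B)).

Definition in_B (u : A + B) : bool := if u is inr _ then true else false.

(** The elements of E that lie in A or in B. *)
Definition pure (u : A + B) : E :=
  match u with inl a => (a, 0) | inr x => (0, x) end.

(** F has weight w if, on pure arguments, its component in A is zero unless the
    number of arguments in B is - w, and its component in B is zero unless that
    number is 1 - w. *)
Definition weight (w : int) F := forall s,
  ((count in_B s)%:Z + w != 0 -> (F (map pure s)).1 = 0) /\
  ((count in_B s)%:Z + w != 1 -> (F (map pure s)).2 = 0).

Lemma pair_eq0 (u : E) : u.1 = 0 -> u.2 = 0 -> u = 0.
Proof. by case: u => a x /= -> ->. Qed.

(** A map with a weight sends pure arguments to zero or to a pure element. *)
Lemma weight_pure w F s : weight w F ->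
  F (map pure s) = 0 \/
  exists2 u, F (map pure s) = pure u & (in_B u)%:Z = (count in_B s)%:Z + w.
Proof.
move=> Fw; have [F1 F2] := Fw s.
have [e0|n0] := eqVneq ((count in_B s)%:Z + w) 0.
  right; exists (inl (F (map pure s)).1); last by rewrite e0.
  by rewrite /= -[in RHS]F2 ?e0 -?surjective_pairing.
have [e1|n1] := eqVneq ((count in_B s)%:Z + w) 1; last first.
  by left; apply: pair_eq0; [apply: F1 | apply: F2].
right; exists (inr (F (map pure s)).2); last by rewrite e1.
by rewrite /= -[in RHS]F1 ?e1 -?surjective_pairing.
Qed.

Lemma weight_linear w a F G :
  weight w F -> weight w G -> weight w (fun t => a *: F t + G t).
Proof.
move=> Fw Gw s; have [F1 F2] := Fw s; have [G1 G2] := Gw s.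
by split=> n; rewrite /= ?F1 ?F2 // ?G1 ?G2 // scaler0 addr0.
Qed.

Lemma eq_weight w F G : F =1 G -> weight w F -> weight w G.
Proof. by move=> FG Fw s; rewrite -!FG. Qed.

Lemma weight_insertion w w' F G i n : multilinear F ->
  weight w F -> weight w' G -> weight (w + w') (insertion F G i n).
Proof.
move=> Fl Fw Gw s; rewrite /insertion -!map_drop -!map_take.
have [->|[u -> Bu]] := weight_pure (take n (drop i s)) Gw.
  by rewrite multilinear_at0.
rewrite -map_cons -map_cat.
have := Fw (take i s ++ u :: drop (i + n) s).
have -> : (count in_B s)%:Z + (w + w') =
    (count in_B (take i s ++ u :: drop (i + n) s))%:Z + w; last by [].
rewrite -{1}(cat_take_drop i s) -{1}(cat_take_drop n (drop i s)) drop_drop.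
by rewrite !count_cat /= (addnC n) !PoszD Bu; lia.
Qed.

Lemma weight_diamond w w' F G p q : multilinear F ->
  weight w F -> weight w' G -> weight (w + w') (diamond F G p q).
Proof.
move=> Fl Fw Gw s; have wi := weight_insertion _ _ Fl Fw Gw s.
rewrite /diamond !raddf_sum; split=> n; apply: big1 => i _ /=.
  by have [-> //] := wi i q.+1; rewrite scaler0.
by have [_ ->] := wi i q.+1; rewrite ?scaler0.
Qed.

Lemma weight_gerstenhaber w w' (f g : cochain E E) :
  weight w f -> weight w' g -> weight (w + w') (gerstenhaber f g).
Proof.
move=> fw gw s; have fl := cochain_multilinear f.
have gl := cochain_multilinear g.
have wfg p q := weight_diamond p q fl fw gw s.
have wgf p q := weight_diamond p q gl gw fw s.
rewrite /= /gerstenhaber_fun !raddf_sum /=; rewrite (addrC w') in wgf.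
split=> n; apply: big1 => p _ /=.
  have [-> // _] := wfg p (size (map pure s) - p.+1)%N.
  have [-> // _] := wgf (size (map pure s) - p.+1)%N p.
  by rewrite scaler0 subr0.
have [_ ->] // := wfg p (size (map pure s) - p.+1)%N.
have [_ ->] // := wgf (size (map pure s) - p.+1)%N p.
by rewrite scaler0 subr0.
Qed.

Lemma multilinear_pure_ext F G : multilinear F -> multilinear G ->
  (forall s, F (map pure s) = G (map pure s)) -> F =1 G.
Proof.
move=> Fl Gl FG t; rewrite -[t]cat0s -[[::]]/(map pure [::]).
elim: t [::] => [|[a x] t IHt] s; first by rewrite cats0 FG.
have -> : (a, x) = 1 *: pure (inl a) + pure (inr x).
  by rewrite scale1r /=; congr pair; rewrite /= ?addr0 ?add0r.
rewrite Fl Gl; congr (_ *: _ + _).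
  by rewrite -!cat_rcons -map_rcons IHt.
by rewrite -!cat_rcons -map_rcons IHt.
Qed.

Lemma weight_eq0 w (f : cochain E E) : 1 < w -> weight w f -> f = 0.
Proof.
move=> w1 fw; apply: cochain_ext.
apply: multilinear_pure_ext; try exact: cochain_multilinear.
move=> s; have [f1 f2] := fw s.
by apply: pair_eq0; [apply: f1 | apply: f2]; lia.
Qed.

(** The sum of the spaces of cochains of different weights is direct. *)
Lemma weight_free (r : seq int) (f : int -> cochain E E) :
  uniq r -> (forall w, weight w (f w)) -> \sum_(w <- r) f w = 0 ->
  forall w, w \in r -> f w = 0.
Proof.
move=> Ur fw f0 w rw; apply: cochain_ext.
apply: multilinear_pure_ext; try exact: cochain_multilinear.
move=> s; move: f0 => /(congr1 (fun g : cochain E E => g (map pure s))).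
rewrite cochain_sum => f0; have [w1 w2] := fw w s; apply: pair_eq0.
  have [e0|/w1//] := eqVneq ((count in_B s)%:Z + w) 0.
  move: f0 => /(congr1 fst).
  rewrite raddf_sum /= (bigD1_seq w) //= big1 ?addr0 //.
  by move=> v nvw; have [-> //] := fw v s; move: nvw e0; lia.
have [e0|/w2//] := eqVneq ((count in_B s)%:Z + w) 1.
move: f0 => /(congr1 snd).
rewrite raddf_sum /= (bigD1_seq w) //= big1 ?addr0 //.
by move=> v nvw; have [_ -> //] := fw v s; move: nvw e0; lia.
Qed.

Lemma weight_free5 (f0 f1 f2 f3 f4 : cochain E E) :
  weight (-2) f0 -> weight (-1) f1 -> weight 0 f2 -> weight 1 f3 ->
  weight 2 f4 ->
  f0 + (f1 + (f2 + (f3 + (f4 + 0)))) = 0 ->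
  [/\ f0 = 0, f1 = 0, f2 = 0 & f3 = 0].
Proof.
move=> w0 w1 w2 w3 w4 sum0.
pose f (w : int) := if w == -2 then f0 else if w == -1 then f1 else
  if w == 0 then f2 else if w == 1 then f3 else if w == 2 then f4 else 0.
have fw w : weight w (f w) by rewrite /f; do !case: eqP => [->|_] //.
have fE w : w \in [:: -2; -1; 0; 1; 2] -> f w = 0.
  by apply: weight_free; rewrite // !big_cons big_nil.
by split; [apply: (fE (-2)) | apply: (fE (-1)) | apply: (fE 0) | apply: (fE 1)].
Qed.

(** The component in B of the values on arguments in A; it is a left inverse of
    the extension by zero. *)
Definition restriction_fun F (s : seq A) : B := (F [seq (a, 0) | a <- s]).2.

Lemma restrictionP (f : cochain E E) : is_cochain (restriction_fun f).
Proof.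
have [fl f0 [n fn]] := cochainP f; split.
- move=> s1 s2 a u v; rewrite /restriction_fun !map_cat /=.
  have -> : (a *: u + v, 0) = a *: (u, 0) + (v, 0) :> E.
    by congr pair; rewrite /= scaler0 addr0.
  by rewrite fl.
- by rewrite /restriction_fun /= f0.
- by exists n => s lts; rewrite /restriction_fun fn ?size_map.
Qed.

Definition restriction (f : cochain E E) : cochain A B :=
  mk_cochain (restrictionP f).

Lemma weight_extension (f : cochain A B) : weight 1 (extension f).
Proof.
move=> s; split=> // ns.
have /hasP[u su Bu] : has in_B s by rewrite has_count; lia.
rewrite /= /extension_fun /=; have /splitPr[s1 s2] := su.
rewrite !map_cat /=; case: u {su} Bu => //= x _.
by rewrite multilinear_at0 //; apply: cochain_multilinear.
Qed.

(** The cochains of weight 1 are the extensions of cochains from A to B. *)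
Lemma restrictionK (f : cochain E E) :
  weight 1 f -> extension (restriction f) = f.
Proof.
move=> fw; apply: cochain_ext.
apply: multilinear_pure_ext; try exact: cochain_multilinear.
move=> s; have [f1 f2] := fw s.
have [e1 e2] := weight_extension (restriction f) s.
rewrite [LHS]surjective_pairing [RHS]surjective_pairing.
rewrite e1 ?f1; [|by lia|by lia]; congr pair.
have [e0|n0] := eqVneq (count in_B s) 0%N; last by rewrite e2 ?f2 //; lia.
rewrite /= /restriction_fun -!map_comp; congr (f _).2; apply/eq_in_map.
move=> u su; suff: ~~ in_B u by case: u {su}.
apply/negP => Bu; move/eqP: e0; rewrite eqn0Ngt -has_count.
by case/hasP; exists u.
Qed.

Lemma extension_is_linear : linear (@extension K A B).
Proof.
move=> a f g; apply: cochain_ext => s; congr pair => /=.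
by rewrite scaler0 addr0.
Qed.

End Weights.

(** * Derived brackets *)

Section DerivedBrackets.
Variables (K : fieldType) (E : lmodType K).
Hypothesis charK0 : [pchar K] =i pred0.
Local Notation "[< f , g >]" := (gerstenhaber f g).

Lemma addrr_eq0 (V : lmodType K) (v : V) : v + v = 0 -> v = 0.
Proof.
move=> v0; have K2 : (2%:R : K) != 0.
  by have /pcharf0P -> := charK0.
by apply: (scalerI K2); rewrite scaler0 scaler_nat mulr2n.
Qed.

(** An associative product is a square-zero element. *)
Lemma gerstenhaber_sqr_eq0 (f : cochain E E) : homog 1 f ->
  (forall u v w, f [:: f [:: u; v]; w] = f [:: u; f [:: v; w]]) ->
  [< f, f >] = 0.
Proof.
move=> f1 fA; apply: cochain_ext => s; rewrite (gerstenhaber_circ _ f1 f1).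
suff -> : circ f 1 f s = 0 by rewrite scaler0 subr0.
have fl := cochain_multilinear f.
case: s => [|u [|v [|w [|z s]]]]; try by rewrite (homog_circ fl f1 f1).
rewrite /circ !big_ord_recl big_ord0 /insertion /= fA.
by rewrite mul0n expr0 scale1r mul1n expr1 scaleN1r addr0 addrN.
Qed.

(** The terms are grouped by weight, in increasing order, for f, g, h of weights
    0, -1, 1. *)
Lemma gerstenhaber_sqr3 (f g h : cochain E E) :
  cochain_deg 1 f -> cochain_deg 1 g -> cochain_deg 1 h ->
  [< f + g + h, f + g + h >] =
  [< g, g >] + (([< f, g >] + [< f, g >])
    + (([< f, f >] + ([< g, h >] + [< g, h >]))
    + (([< f, h >] + [< f, h >]) + ([< h, h >] + 0)))).
Proof.
have C1 (k l : cochain E E) : cochain_deg 1 k -> cochain_deg 1 l ->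
    [< k, l >] = [< l, k >].
  by move=> k1 l1; rewrite (gerstenhaberC k1 l1) mulr1 expr1z scaleN1r opprK.
move=> f1 g1 h1; rewrite !(gerstenhaberDl, gerstenhaberDr) /=.
rewrite (C1 _ _ g1 f1) (C1 _ _ h1 f1) (C1 _ _ h1 g1).
abel.
Qed.

(* The predicate ab stands for an abelian subspace that is stable under [m, -]
   and [[n, -], -]. *)
Variables (m n t : cochain E E) (ab : cochain E E -> Prop).
Hypotheses (m_deg : cochain_deg 1 m) (n_deg : cochain_deg 1 n).
Hypotheses (nn : [< n, n >] = 0) (mn : [< m, n >] = 0).
Hypothesis mm : [< m, m >] = - ([< n, t >] + [< n, t >]).
Hypothesis ab_bracket : forall x y, ab x -> ab y -> [< x, y >] = 0.
Hypothesis m_ab : forall x, ab x -> ab [< m, x >].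
Hypothesis n_ab : forall x y, ab x -> ab y -> ab [< [< n, x >], y >].

Section Relations.
Variables (p q : int) (x y : cochain E E).
Hypotheses (xp : cochain_deg p x) (yq : cochain_deg q y).
Hypotheses (xw : ab x) (yw : ab y).

Lemma derived_bracketC :
  [< [< n, x >], y >] = (-1) ^ (p * q) *: [< [< n, y >], x >].
Proof.
rewrite (gerstenhaber_jacobi n_deg xp yq) (ab_bracket xw yw).
by rewrite gerstenhaber0r add0r.
Qed.

(** The relation with one argument, for l_0 = t, l_1 = [m, -] and
    l_2 = [[n, -], -]. *)
Lemma derived_bracket_relation1 : [< [< n, t >], x >] + [< m, [< m, x >] >] = 0.
Proof.
have := gerstenhaber_jacobi m_deg m_deg xp.
rewrite mm gerstenhaberNl gerstenhaberDl /=.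
rewrite (gerstenhaberC (gerstenhaber_deg m_deg xp) m_deg).
rewrite scalerN !scalerA !(signz_if, odd_abszM, odd_abszD) => /= e.
apply: addrr_eq0; move: e.
by case: (odd (absz p));
  rewrite /= !(mulr1, mul1r, mulrN, mulNr, opprK, scale1r, scaleN1r) => e;
  rewrite addrACA -[X in _ + X]e; abel.
Qed.

Lemma anticommuting_bracket : [< m, [< n, x >] >] = - [< n, [< m, x >] >].
Proof.
have := gerstenhaber_jacobi m_deg n_deg xp.
rewrite mn gerstenhaber0l (gerstenhaberC (gerstenhaber_deg m_deg xp) n_deg).
rewrite scalerN !scalerA !(signz_if, odd_abszM, odd_abszD) => /=.
move/esym/eqP; rewrite addr_eq0 => /eqP ->.
by case: (odd (absz p));
  rewrite /= !(mulr1, mul1r, mulrN, mulNr, opprK, scale1r, scaleN1r).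
Qed.

Lemma square_zero_bracket : [< n, [< n, x >] >] = 0.
Proof.
apply: addrr_eq0.
have := gerstenhaber_jacobi n_deg n_deg xp.
rewrite nn gerstenhaber0l (gerstenhaberC (gerstenhaber_deg n_deg xp) n_deg).
rewrite scalerN !scalerA !(signz_if, odd_abszM, odd_abszD) => /= ->.
by case: (odd (absz p));
  rewrite /= !(mulr1, mul1r, mulrN, mulNr, opprK, scale1r, scaleN1r).
Qed.

End Relations.

(** The relation with two arguments, from [m, n] = 0. *)
Lemma derived_bracket_relation2 (p q : int) (x y : cochain E E) :
  cochain_deg p x -> cochain_deg q y -> ab x -> ab y ->
  [< m, [< [< n, x >], y >] >] + [< [< n, [< m, x >] >], y >]
  + (-1) ^ (p * q) *: [< [< n, [< m, y >] >], x >] = 0.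
Proof.
move=> xp yq xw yw.
have nx := gerstenhaber_deg n_deg xp; have my := gerstenhaber_deg m_deg yq.
have := gerstenhaber_jacobi m_deg nx yq.
rewrite (anticommuting_bracket xp) gerstenhaberNl (gerstenhaberC my nx).
rewrite (derived_bracketC xp my xw (m_ab yw)).
rewrite !(scalerN, scalerA) => /(canLR (addrK _)) <-.
rewrite !(signz_if, odd_abszM, odd_abszD) /=.
by case: (odd (absz p)); case: (odd (absz q));
  rewrite /= ?(mulr1, mul1r, mulrN, mulNr, opprK, scale1r, scaleN1r); abel.
Qed.

(** The relation with three arguments, from [n, n] = 0. *)
Lemma derived_bracket_relation3 (p q r : int) (x y z : cochain E E) :
  cochain_deg p x -> cochain_deg q y -> cochain_deg r z ->
  ab x -> ab y -> ab z ->
  let L u v := [< [< n, u >], v >] in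
  L (L x y) z + (-1) ^ (q * r) *: L (L x z) y
  + (-1) ^ (p * q + p * r) *: L (L y z) x = 0.
Proof.
move=> xp yq zr xw yw zw L.
have nx := gerstenhaber_deg n_deg xp; have ny := gerstenhaber_deg n_deg yq.
have Lxz := gerstenhaber_deg nx zr; have Lyz := gerstenhaber_deg ny zr.
have := gerstenhaber_jacobi n_deg nx yq.
rewrite (square_zero_bracket xp) gerstenhaber0l => /esym/eqP.
rewrite addr_eq0 => /eqP nL.
rewrite {1}/L {1}/L nL gerstenhaberNl /= gerstenhaberZl.
rewrite (gerstenhaber_jacobi ny nx zr) (gerstenhaberC Lyz nx).
rewrite (derived_bracketC yq Lxz yw (n_ab xw zw)).
rewrite (derived_bracketC xp Lyz xw (n_ab yw zw)).
rewrite -/(L x z) -/(L y z) -/(L (L x z) y) -/(L (L y z) x).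
rewrite !(scalerN, scalerDr, scalerA) !(signz_if, odd_abszM, odd_abszD) /=.
by case: (odd (absz p)); case: (odd (absz q)); case: (odd (absz r));
  rewrite /= ?(mulr1, mul1r, mulrN, mulNr, opprK, scale1r, scaleN1r); abel.
Qed.

End DerivedBrackets.

(** * The components of the associativity equation *)

HB.instance Definition _ (K : fieldType) (A B : lmodType K) :=
  GRing.isLinear.Build K (cochain A B) (cochain (A * B)%type (A * B)%type)
    *:%R (@extension K A B) (@extension_is_linear K A B).

Section Components.
Variables (K : fieldType) (A B : lmodType K) (Q : quasi_twilled A B).
Hypothesis charK0 : [pchar K] =i pred0.
Local Notation E := (A * B)%type.
Local Notation "[< f , g >]" := (gerstenhaber f g).
Local Notation m := (cochain2 (mu_tri Q)).
Local Notation n := (cochain2 (nu_harp Q)).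
Local Notation th := (extension (cochain2 (theta Q))).

Lemma cochain2_homog (F G : lmodType K) (h : {bilinear F -> F -> G}) :
  homog 1 (cochain2 h).
Proof. by case=> [|u [|v [|w s]]]. Qed.

Lemma extension_homog p (f : cochain A B) : homog p f -> homog p (extension f).
Proof. by move=> fp s ns; rewrite /= /extension_fun fp // size_map. Qed.

Lemma extension_deg p (f : cochain A B) :
  cochain_deg p f -> cochain_deg p (extension f).
Proof. by move=> fp s ns; rewrite /= /extension_fun fp // size_map. Qed.

Lemma restriction_deg p (f : cochain E E) :
  cochain_deg p f -> cochain_deg p (restriction f).
Proof. by move=> fp s ns; rewrite /= /restriction_fun fp // size_map. Qed.

Lemma mu_tri_deg : cochain_deg 1 m.
Proof. exact/homog_cochain_deg/cochain2_homog. Qed.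
Lemma nu_harp_deg : cochain_deg 1 n.
Proof. exact/homog_cochain_deg/cochain2_homog. Qed.
Lemma theta_deg : cochain_deg 1 th.
Proof. exact/homog_cochain_deg/extension_homog/cochain2_homog. Qed.

Lemma weight_mu_tri : weight 0 m.
Proof.
by case=> [|[a|x] [|[b|y] [|w s]]] //; split=> //= _;
  rewrite /mu_tri /= ?linear0l ?linear0r ?addr0.
Qed.

Lemma weight_nu_harp : weight (-1) n.
Proof.
by case=> [|[a|x] [|[b|y] [|w s]]] //; split=> //= _;
  rewrite /nu_harp /= ?linear0l ?linear0r ?addr0.
Qed.

Lemma weight_theta : weight 1 th.
Proof. exact: weight_extension. Qed.

(** The sum m + n + th is the multiplication of the quasi-twilled algebra. *)
Lemma total_sqr_eq0 : [< m + n + th, m + n + th >] = 0.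
Proof.
have tE (u v : E) : (m + n + th) [:: u; v] =
    (mu Q u.1 v.1 + lharp Q u.1 v.2 + rharp Q u.2 v.1,
     nu Q u.2 v.2 + rtri Q u.1 v.2 + ltri Q u.2 v.1 + theta Q u.1 v.1).
  rewrite !cochainD /=; congr pair; rewrite /= ?addr0 ?addrA //.
  by congr (_ + _); rewrite addrC addrA.
apply: (gerstenhaber_sqr_eq0 (f := m + n + th)) => [s ns | u v w].
  have th0 : th s = 0 by apply: extension_homog ns; apply: cochain2_homog.
  by rewrite !cochainD !cochain2_homog // th0 !addr0.
rewrite !tE; have := quasi_twilled_mulA Q u v w.
by move=> ->.
Qed.

Lemma quasi_twilled_components :
  [/\ [< n, n >] = 0, [< m, n >] = 0,
      [< m, m >] = - ([< n, th >] + [< n, th >]) & [< m, th >] = 0].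
Proof.
have wm := weight_mu_tri; have wn := weight_nu_harp; have wt := weight_theta.
have wD w (f g : cochain E E) : weight w f -> weight w g -> weight w (f + g).
  move=> fw gw; apply: eq_weight (weight_linear 1 fw gw) => s.
  by rewrite scale1r.
have w1 : weight (-1) ([< m, n >] + [< m, n >]).
  by apply: (wD); apply: (weight_gerstenhaber wm wn).
have w2 : weight 0 ([< m, m >] + ([< n, th >] + [< n, th >])).
  apply: (wD); first exact: (weight_gerstenhaber wm wm).
  by apply: (wD); apply: (weight_gerstenhaber wn wt).
have w3 : weight 1 ([< m, th >] + [< m, th >]).
  by apply: (wD); apply: (weight_gerstenhaber wm wt).
have := total_sqr_eq0.
rewrite (gerstenhaber_sqr3 mu_tri_deg nu_harp_deg theta_deg) => sum0.
have := weight_free5 (weight_gerstenhaber wn wn) w1 w2 w3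
  (weight_gerstenhaber wt wt) sum0.
case=> nn mn mm mt; split.
- exact: nn.
- exact: (addrr_eq0 charK0 mn).
- by move/eqP: mm; rewrite addr_eq0 => /eqP.
- exact: (addrr_eq0 charK0 mt).
Qed.

Lemma gerstenhaber_weight1 (f g : cochain E E) :
  weight 1 f -> weight 1 g -> [< f, g >] = 0.
Proof. by move=> fw gw; apply: weight_eq0 (weight_gerstenhaber fw gw). Qed.

Lemma mu_tri_bracket_weight (f : cochain E E) :
  weight 1 f -> weight 1 [< m, f >].
Proof. by move=> fw; apply: (weight_gerstenhaber weight_mu_tri fw). Qed.

Lemma derived_bracket_weight (f g : cochain E E) :
  weight 1 f -> weight 1 g -> weight 1 [< [< n, f >], g >].
Proof.
move=> fw gw.
exact: (weight_gerstenhaber (weight_gerstenhaber weight_nu_harp fw) gw).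
Qed.

End Components.

(** * Shuffles and Koszul signs for at most three arguments *)

Section SmallShuffles.
Local Notation j0 := ord0.
Local Notation j1 := (lift ord0 ord0).
Local Notation j2 := (lift ord0 (lift ord0 ord0)).

Lemma ord2P (i : 'I_2) : i = j0 \/ i = j1.
Proof. by case: i => [[|[|i]] lti] //; [left | right]; apply: val_inj. Qed.

Lemma ord3P (i : 'I_3) : [\/ i = j0, i = j1 | i = j2].
Proof.
by case: i => [[|[|[|i]]] lti] //;
  [apply: Or31 | apply: Or32 | apply: Or33]; apply: val_inj.
Qed.

Lemma perm2_eq (s t : 'S_2) : s j0 = t j0 :> nat -> s j1 = t j1 :> nat -> s = t.
Proof.
by move=> e0 e1; apply/permP => i; apply: val_inj; have [->|->] := ord2P i.
Qed.

Lemma perm3_eq (s t : 'S_3) : s j0 = t j0 :> nat -> s j1 = t j1 :> nat ->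
  s j2 = t j2 :> nat -> s = t.
Proof.
move=> e0 e1 e2; apply/permP => i; apply: val_inj.
by have [->|->|->] := ord3P i.
Qed.

Lemma perm_val_neq k (s : 'S_k) (i j : 'I_k) : i != j -> s i != s j :> nat.
Proof. by move=> nij; rewrite val_eqE (inj_eq perm_inj). Qed.

Lemma perm2P (s : 'S_2) : s = 1%g \/ s = tperm j0 j1.
Proof.
have n01 := @perm_val_neq 2 s j0 j1 isT.
have := ltn_ord (s j0); have := ltn_ord (s j1) => lt1 lt0.
have [e|ne] := eqVneq (s j0 : nat) 0%N.
  by left; apply: perm2_eq; rewrite perm1 ?lift0 /=; lia.
by right; apply: perm2_eq; rewrite ?tpermL ?tpermR ?lift0 /=; lia.
Qed.

Lemma perm1_eq (s : 'S_1) : s = 1%g.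
Proof. by apply/permP => i; rewrite !ord1. Qed.

Lemma perm0_eq (s : 'S_0) : s = 1%g.
Proof. by apply/permP => -[]. Qed.

Lemma shuffle1 k i : shuffle i (1%g : 'S_k).
Proof.
apply/forallP => a; apply/forallP => b; apply/implyP => /andP[lt_ab _].
by rewrite !perm1.
Qed.

(** The permutations 021 and 120 of {0, 1, 2} are, with the identity, the
    (2,1)-shuffles; they are named by their values. *)
Definition perm021 : 'S_3 := tperm j1 j2.
Definition perm120 : 'S_3 := (tperm j0 j1 * tperm j0 j2)%g.

Lemma perm021E : (perm021 j0 = j0) * (perm021 j1 = j2) * (perm021 j2 = j1).
Proof. by rewrite /perm021 tpermL tpermR tpermD. Qed.

Lemma perm120E : (perm120 j0 = j1) * (perm120 j1 = j2) * (perm120 j2 = j0).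
Proof.
rewrite /perm120 !permM tpermL tpermR tpermL.
by rewrite (@tpermD _ j0 j1 j2) // tpermR tpermD.
Qed.

Lemma shuffle23E (s : 'S_3) : shuffle 2 s = (s j0 < s j1)%N.
Proof.
apply/forallP/idP => [/(_ j0)/forallP/(_ j1)//|lt01] a.
apply/forallP => b; apply/implyP.
by have [->|->|->] := ord3P a; have [->|->|->] := ord3P b.
Qed.

Lemma shuffle22E (s : 'S_2) : shuffle 2 s = (s j0 < s j1)%N.
Proof.
apply/forallP/idP => [/(_ j0)/forallP/(_ j1)//|lt01] a.
apply/forallP => b; apply/implyP.
by have [->|->] := ord2P a; have [->|->] := ord2P b.
Qed.

Lemma shuffle12 (s : 'S_2) : shuffle 1 s.
Proof.
apply/forallP => a; apply/forallP => b; apply/implyP.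
by have [->|->] := ord2P a; have [->|->] := ord2P b.
Qed.

Section Sums.
Variable V : zmodType.

Lemma sum_shuffle0 i (F : 'S_0 -> V) : \sum_(s | shuffle i s) F s = F 1%g.
Proof.
rewrite (bigD1 1%g) ?shuffle1 //= big1 ?addr0 // => s /andP[_].
by rewrite (perm0_eq s) eqxx.
Qed.

Lemma sum_shuffle1 i (F : 'S_1 -> V) : \sum_(s | shuffle i s) F s = F 1%g.
Proof.
rewrite (bigD1 1%g) ?shuffle1 //= big1 ?addr0 // => s /andP[_].
by rewrite (perm1_eq s) eqxx.
Qed.

Lemma sum_shuffle12 (F : 'S_2 -> V) :
  \sum_(s | shuffle 1 s) F s = F 1%g + F (tperm j0 j1).
Proof.
rewrite (bigD1 1%g) ?shuffle1 // (bigD1 (tperm j0 j1)) /=; last first.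
  rewrite shuffle12 /=; apply/eqP => /permP/(_ j0).
  by rewrite tpermL perm1.
rewrite big1 ?addr0 // => s /andP[/andP[_ n1] nt].
by have [e|e] := perm2P s; move: n1 nt; rewrite e eqxx.
Qed.

Lemma sum_shuffle22 (F : 'S_2 -> V) : \sum_(s | shuffle 2 s) F s = F 1%g.
Proof.
rewrite (bigD1 1%g) ?shuffle1 //= big1 ?addr0 // => s /andP[].
rewrite shuffle22E; have [->|->] := perm2P s; first by rewrite eqxx.
by rewrite tpermL tpermR.
Qed.

Lemma sum_shuffle23 (F : 'S_3 -> V) :
  \sum_(s | shuffle 2 s) F s = F 1%g + F perm021 + F perm120.
Proof.
rewrite (bigD1 1%g) ?shuffle1 // (bigD1 perm021) /=; last first.
  rewrite shuffle23E !perm021E /=; apply/eqP => /permP/(_ j1).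
  by rewrite perm021E perm1.
rewrite (bigD1 perm120) /=; last first.
  rewrite shuffle23E !perm120E /=.
  by apply/andP; split; apply/eqP => /permP/(_ j0);
    rewrite perm120E ?perm021E ?perm1.
rewrite big1 ?addr0 ?addrA // => s.
rewrite shuffle23E => /andP[/andP[/andP[sh /eqP n1] /eqP n2] /eqP n3].
have n02 := @perm_val_neq 3 s j0 j2 isT.
have n12 := @perm_val_neq 3 s j1 j2 isT.
have := ltn_ord (s j0); have := ltn_ord (s j1); have := ltn_ord (s j2).
move=> lt2 lt1 lt0; exfalso.
have [e0|ne0] := eqVneq (s j0 : nat) 0%N; last first.
  by apply: n3; apply: perm3_eq; rewrite perm120E ?lift0 /=; lia.
have [e1|ne1] := eqVneq (s j1 : nat) 1%N.
  by apply: n1; apply: perm3_eq; rewrite perm1 ?lift0 /=; lia.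
by apply: n2; apply: perm3_eq; rewrite perm021E ?lift0 /=; lia.
Qed.

End Sums.

Section KoszulSigns.
Variable K : fieldType.

Lemma koszul_sign1 k (d : 'I_k -> int) : koszul_sign K d 1 = 1.
Proof.
rewrite /koszul_sign big1 // => i _; rewrite big1 // => j /andP[lt_ij].
by rewrite !perm1 ltnNge (ltnW lt_ij).
Qed.

Lemma koszul_sign2 (d : 'I_2 -> int) :
  koszul_sign K d (tperm j0 j1) = (-1) ^ (d j0 * d j1).
Proof.
rewrite /koszul_sign.
under eq_bigr => i _ do rewrite big_mkcond /= !big_ord_recl big_ord0 /=.
rewrite !big_ord_recl big_ord0.
by rewrite !tpermL !tpermR /= !(mulr1, mul1r) mulrC.
Qed.

Lemma koszul_sign021 (d : 'I_3 -> int) :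
  koszul_sign K d perm021 = (-1) ^ (d j1 * d j2).
Proof.
rewrite /koszul_sign.
under eq_bigr => i _ do rewrite big_mkcond /= !big_ord_recl big_ord0 /=.
rewrite !big_ord_recl big_ord0.
by rewrite !perm021E /= !(mulr1, mul1r) mulrC.
Qed.

Lemma koszul_sign120 (d : 'I_3 -> int) :
  koszul_sign K d perm120 = (-1) ^ (d j0 * d j1 + d j0 * d j2).
Proof.
rewrite /koszul_sign.
under eq_bigr => i _ do rewrite big_mkcond /= !big_ord_recl big_ord0 /=.
rewrite !big_ord_recl big_ord0.
rewrite !perm120E /= !(mulr1, mul1r).
by rewrite expfzDr ?oppr_eq0 ?oner_neq0 // !(mulrC (d j0)).
Qed.

End KoszulSigns.

Section Lists.
Variables (T : Type).
Lemma image_ord0 (x : 'I_0 -> T) : [seq x i | i : 'I_0] = [::].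
Proof. by rewrite /image_mem enum_ord0. Qed.
Lemma image_ord1 (x : 'I_1 -> T) : [seq x i | i : 'I_1] = [:: x j0].
Proof. by rewrite /image_mem !enum_ordSl enum_ord0. Qed.
Lemma image_ord2 (x : 'I_2 -> T) : [seq x i | i : 'I_2] = [:: x j0; x j1].
Proof. by rewrite /image_mem !enum_ordSl enum_ord0. Qed.
Lemma image_ord3 (x : 'I_3 -> T) : [seq x i | i : 'I_3] = [:: x j0; x j1; x j2].
Proof. by rewrite /image_mem !enum_ordSl enum_ord0. Qed.
End Lists.

End SmallShuffles.

(** * The grading of the space of cochains *)

Section Grading.
Variables (K : fieldType) (E F : lmodType K).

(** The homogeneous component of degree p of f. *)
Definition component_fun (f : seq E -> F) (p : int) (s : seq E) : F :=
  if (size s)%:Z == p + 1 then f s else 0.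

Lemma componentP (f : cochain E F) p : is_cochain (component_fun f p).
Proof.
have [fl f0 [n fn]] := cochainP f; split.
- move=> s1 s2 a u v; rewrite /component_fun !size_cat /=.
  by case: ifP; rewrite ?fl // scaler0 addr0.
- by rewrite /component_fun f0; case: ifP.
- by exists n => s lts; rewrite /component_fun fn //; case: ifP.
Qed.

Definition component (f : cochain E F) p : cochain E F :=
  mk_cochain (componentP f p).

Lemma component_deg (f : cochain E F) p : cochain_deg p (component f p).
Proof. by move=> s /negPf ns; rewrite /= /component_fun ns. Qed.

Lemma cochain_grading : is_grading (@cochain_deg K E F).
Proof.
split; first exact: cochain_deg0.
- move=> p a f g fp gp s ns.
  by rewrite cochainD cochainZ fp ?gp // scaler0 addr0.
- move=> f; have [fl f0 [n fn]] := cochainP f.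
  exists (map Posz (iota 0 n)), (component f).
  split; first exact: component_deg.
  apply: cochain_ext => s; rewrite cochain_sum big_map.
  have [s0|s0] := posnP (size s).
    rewrite (size0nil s0) f0 big1 // => i _.
    by rewrite /= /component_fun f0; case: ifP.
  have [lts|les] := ltnP n (size s).
    rewrite fn // big1 // => i _.
    by rewrite /= /component_fun fn //; case: ifP.
  rewrite (bigD1_seq (size s).-1) ?iota_uniq ?mem_iota //=; last by lia.
  rewrite big1 ?addr0 => [|i ni].
    by rewrite /component_fun; case: eqP => //; lia.
  by rewrite /component_fun; case: eqP => //; lia.
- move=> r f Ur fd sum0 p rp; apply: cochain_ext => s.
  have [size_s|ns] := eqVneq (size s)%:Z (p + 1); last by rewrite fd.
  move: sum0 => /(congr1 (fun g : cochain E F => g s)); rewrite cochain_sum.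
  rewrite (bigD1_seq p) //= big1 ?addr0 // => q nqp.
  by rewrite fd // size_s; lia.
Qed.

End Grading.

(** * The curved L-infinity algebra of a quasi-twilled algebra *)

Section TwilledBrackets.
Variables (K : fieldType) (A B : lmodType K) (Q : quasi_twilled A B).
Hypothesis charK0 : [pchar K] =i pred0.
Local Notation E := (A * B)%type.
Local Notation "[< f , g >]" := (gerstenhaber f g).
Local Notation m := (cochain2 (mu_tri Q)).
Local Notation n := (cochain2 (nu_harp Q)).
Local Notation th := (extension (cochain2 (theta Q))).
Local Notation ext := (@extension K A B).
Implicit Types f g h : cochain A B.

(** The brackets l_1 and l_2.  Taking restrictions loses nothing, as both
    brackets are cochains of weight 1. *)
Definition twilled_bracket1 f : cochain A B := restriction [< m, ext f >].
Definition twilled_bracket2 f g : cochain A B :=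
  restriction [< [< n, ext f >], ext g >].

(** The structure maps l_0, l_1, l_2 and l_k = 0 for k >= 3. *)
Definition twilled_brackets (s : seq (cochain A B)) : cochain A B :=
  match s with
  | [::] => cochain2 (theta Q)
  | [:: f] => twilled_bracket1 f
  | [:: f; g] => twilled_bracket2 f g
  | _ => 0
  end.

Lemma extension_bracket1 f : ext (twilled_bracket1 f) = [< m, ext f >].
Proof. exact/restrictionK/mu_tri_bracket_weight/weight_extension. Qed.

Lemma extension_bracket2 f g :
  ext (twilled_bracket2 f g) = [< [< n, ext f >], ext g >].
Proof.
by apply/restrictionK/derived_bracket_weight; apply: weight_extension.
Qed.

Lemma twilled_brackets_large s : (3 <= size s)%N -> twilled_brackets s = 0.
Proof. by case: s => [|f [|g [|h s]]]. Qed.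

Lemma restriction_linear : linear (@restriction K A B).
Proof. by move=> a f g; apply: cochain_ext. Qed.

Lemma twilled_brackets_multilinear : multilinear twilled_brackets.
Proof.
move=> s1 s2 a f g.
have ext_lin := @extension_is_linear K A B.
case: s1 => [|f1 [|f2 s1]]; last first.
- by rewrite !twilled_brackets_large ?scaler0 ?addr0 // size_cat /= addnS.
- case: s2 => [|f2 s2] /=; last by rewrite scaler0 addr0.
  by rewrite /twilled_bracket2 ext_lin linearPr restriction_linear.
- case: s2 => [|f2 [|f3 s2]] /=; last by rewrite scaler0 addr0.
  + by rewrite /twilled_bracket1 ext_lin linearPr restriction_linear.
  + rewrite /twilled_bracket2 ext_lin linearPr.
    by rewrite gerstenhaberDl gerstenhaberZl restriction_linear.
Qed.

Lemma twilled_brackets_degree k (d : 'I_k -> int) (x : 'I_k -> cochain A B) :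
  (forall i, cochain_deg (d i) (x i)) ->
  cochain_deg (1 + \sum_(i < k) d i) (twilled_brackets [seq x i | i : 'I_k]).
Proof.
case: k d x => [|[|[|k]]] d x xd; last first.
- by rewrite twilled_brackets_large ?size_image ?card_ord.
- rewrite image_ord2 !big_ord_recl big_ord0 addr0 addrA.
  apply: restriction_deg; apply: gerstenhaber_deg; last exact: extension_deg.
  by apply: gerstenhaber_deg; [apply: nu_harp_deg | apply: extension_deg].
- rewrite image_ord1 big_ord_recl big_ord0 addr0.
  apply: restriction_deg; apply: gerstenhaber_deg; last exact: extension_deg.
  exact: mu_tri_deg.
- rewrite image_ord0 big_ord0 addr0.
  exact/homog_cochain_deg/cochain2_homog.
Qed.

Lemma twilled_bracket2C p q f g : cochain_deg p f -> cochain_deg q g ->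
  twilled_bracket2 f g = (-1) ^ (p * q) *: twilled_bracket2 g f.
Proof.
move=> fp gq; apply: extension_inj; rewrite linearZ /= !extension_bracket2.
pose P (h : cochain E E) := weight 1 h.
apply: (derived_bracketC (ab := P) (nu_harp_deg Q)).
- exact: gerstenhaber_weight1.
- exact: extension_deg.
- exact: extension_deg.
- exact: weight_extension.
- exact: weight_extension.
Qed.

Lemma twilled_brackets_symmetric k (d : 'I_k -> int) (x : 'I_k -> cochain A B)
    (s : 'S_k) : (forall i, cochain_deg (d i) (x i)) ->
  twilled_brackets [seq x i | i : 'I_k] =
  koszul_sign K d s *: twilled_brackets [seq x (s i) | i : 'I_k].
Proof.
have id1 j (y : 'I_j -> cochain A B) (e : 'I_j -> int) :
    twilled_brackets [seq y i | i : 'I_j] = koszul_sign K e 1 *: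
      twilled_brackets [seq y ((1%g : 'S_j) i) | i : 'I_j].
  rewrite koszul_sign1 scale1r; congr twilled_brackets.
  by apply: eq_image => // i; rewrite perm1.
case: k d x s => [|[|[|k]]] d x s xd; last first.
- by rewrite !twilled_brackets_large ?size_image ?card_ord // scaler0.
- have [->|->] := perm2P s; first exact: id1.
  rewrite !image_ord2 koszul_sign2 tpermL tpermR.
  exact: twilled_bracket2C.
- by rewrite (perm1_eq s); apply: id1.
- by rewrite (perm0_eq s); apply: id1.
Qed.

(** In the relation with k arguments, only i = k - 1 and i = k contribute, and
    only if i <= 2. *)
Lemma twilled_relation_trivial (k i : nat) (x : 'I_k -> cochain A B) :
  (i <= k)%N -> (2 < i)%N || (i + 1 < k)%N ->
  twilled_brackets (twilled_brackets (take i [seq x j | j : 'I_k])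
                    :: drop i [seq x j | j : 'I_k]) = 0.
Proof.
move=> le_ik; have size_x : size [seq x j | j : 'I_k] = k.
  by rewrite size_image card_ord.
have [lt_i _|le_i lt_k] := ltnP 2 i; last first.
  by apply: twilled_brackets_large; rewrite /= size_drop size_x; lia.
rewrite [twilled_brackets (take _ _)]twilled_brackets_large; last first.
  by rewrite size_take size_x; case: ifP; lia.
exact: (multilinear_at0 [::] _ twilled_brackets_multilinear).
Qed.

Lemma twilled_brackets_relation k (d : 'I_k -> int) (x : 'I_k -> cochain A B) :
  (forall i, cochain_deg (d i) (x i)) ->
  \sum_(i < k.+1) \sum_(s : 'S_k | shuffle i s) koszul_sign K d s *:
    (let xs := [seq x (s j) | j : 'I_k] in
     twilled_brackets (twilled_brackets (take i xs) :: drop i xs)) = 0.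
Proof.
have [nn mn mm mt] := quasi_twilled_components Q charK0.
have w1 f : weight 1 (ext f) by apply: weight_extension.
have m_deg := mu_tri_deg Q; have n_deg := nu_harp_deg Q.
have ab := @gerstenhaber_weight1 K A B.
pose P (h : cochain E E) := weight 1 h.
have abP (h h' : cochain E E) : P h -> P h' -> [< h, h' >] = 0 by apply: ab.
have mP (h : cochain E E) : P h -> P [< m, h >] by apply: mu_tri_bracket_weight.
have nP (h h' : cochain E E) : P h -> P h' -> P [< [< n, h >], h' >].
  by apply: derived_bracket_weight.
case: k d x => [|[|[|[|k]]]] d x xd; last first.
- apply: big1 => i _; apply: big1 => s _; cbv zeta.
  rewrite twilled_relation_trivial ?scaler0 //; have := ltn_ord i; lia.
- rewrite !big_ord_recl big_ord0 !lift0 -[nat_of_ord ord0]/0%N; cbv zeta.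
  rewrite big1 => [|s _]; last by rewrite twilled_relation_trivial ?scaler0.
  rewrite big1 => [|s _]; last by rewrite twilled_relation_trivial ?scaler0.
  rewrite [X in _ + (_ + (_ + (X + _)))]big1 => [|s _]; last first.
    by rewrite twilled_relation_trivial ?scaler0.
  rewrite !(add0r, addr0) sum_shuffle23 koszul_sign1 koszul_sign021.
  rewrite koszul_sign120 scale1r !image_ord3 !perm1 !perm021E !perm120E /=.
  apply: extension_inj.
  rewrite !linearD !linearZ /= !extension_bracket2 linear0.
  by apply: (@derived_bracket_relation3 _ _ charK0 n P n_deg nn abP nP);
    first [exact: extension_deg | exact: w1].
- rewrite !big_ord_recl big_ord0 !lift0 -[nat_of_ord ord0]/0%N; cbv zeta.
  rewrite big1 => [|s _]; last by rewrite twilled_relation_trivial ?scaler0.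
  rewrite add0r addr0 sum_shuffle12 sum_shuffle22 !koszul_sign1 koszul_sign2.
  rewrite !scale1r !image_ord2 !perm1 tpermL tpermR /=.
  apply: extension_inj; rewrite !linearD !linearZ /=.
  rewrite !(extension_bracket2, extension_bracket1) linear0 addrC addrA.
  by apply: (@derived_bracket_relation2 _ _ m n P m_deg n_deg mn abP mP);
    first [exact: extension_deg | exact: w1].
- rewrite !big_ord_recl big_ord0 !sum_shuffle1 !koszul_sign1 !scale1r.
  rewrite !image_ord1 !perm1 lift0 /= addr0; apply: extension_inj.
  rewrite linearD /= extension_bracket2 !extension_bracket1 linear0.
  by apply: (@derived_bracket_relation1 _ _ charK0 m n th m_deg mm);
    apply: extension_deg.
- rewrite big_ord_recl big_ord0 sum_shuffle0 koszul_sign1 scale1r image_ord0.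
  rewrite /= addr0; apply: extension_inj.
  by rewrite extension_bracket1 linear0.
Qed.

Lemma twilled_brackets_curved_Linfty :
  curved_Linfty (@cochain_deg K A B) twilled_brackets.
Proof.
split.
- exact: cochain_grading.
- exact: twilled_brackets_multilinear.
- exact: twilled_brackets_degree.
- exact: twilled_brackets_symmetric.
- exact: twilled_brackets_relation.
Qed.

(** The Maurer-Cartan sum stops at k = 2, whatever the bound on the number of
    nonzero terms. *)
Lemma twilled_maurer_cartanE (x : cochain A B) :
  maurer_cartan (@cochain_deg K A B) twilled_brackets x <->
  cochain_deg 0 x /\
  cochain2 (theta Q) + twilled_bracket1 x
    + (2%:R)^-1 *: twilled_bracket2 x x = 0.
Proof.
have large k : (3 <= k)%N -> twilled_brackets (nseq k x) = 0.
  by move=> lek; apply: twilled_brackets_large; rewrite size_nseq.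
have sum3 N : (3 <= N)%N -> \sum_(1 <= k < N)
    ((k`!)%:R : K)^-1 *: twilled_brackets (nseq k x) =
    twilled_bracket1 x + (2%:R)^-1 *: twilled_bracket2 x x.
  move=> leN; rewrite (big_cat_nat (m := 1) (n := 3) isT leN) //=.
  rewrite [X in _ + X]big1_seq ?addr0.
    by rewrite big_ltn // big_nat1 (_ : 1`! = 1)%N // invr1 scale1r.
  move=> k; rewrite mem_index_iota => /andP[_ /andP[lek _]].
  by rewrite large ?scaler0.
split=> [[x0 [N [lN sumN]]]|[x0 sum0]]; split=> //.
  rewrite -addrA -(sum3 (maxn N 3)) ?leq_maxr //.
  (* For N <= 1 the bound N makes l_k(x, ..., x) vanish for all k >= 1. *)
  have [le_N|lt_N] := leqP N 1.
    rewrite -[RHS]sumN [in RHS]big_geq //; congr (_ + _).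
    apply: big1_seq => k; rewrite mem_index_iota => /andP[_ /andP[k1 _]].
    by rewrite lN ?scaler0 // (leq_trans le_N).
  rewrite (big_cat_nat (ltnW lt_N) (leq_maxl N 3)) /=.
  rewrite [X in _ + (_ + X)]big1_seq ?addr0 // => k.
  rewrite mem_index_iota => /andP[_ /andP[k1 _]].
  by rewrite lN ?scaler0.
by exists 3%N; rewrite sum3 // addrA.
Qed.

Lemma gerstenhaber_unary (f g : cochain E E) u v : homog 1 f -> homog 0 g ->
  [< f, g >] [:: u; v] =
  f [:: g [:: u]; v] + f [:: u; g [:: v]] - g [:: f [:: u; v]].
Proof.
move=> f1 g0; rewrite (gerstenhaber_circ _ f1 g0).
rewrite /circ !big_ord_recl !big_ord0 /insertion /=.
by rewrite !muln0 !mul0n !expr0 !scale1r !addr0.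
Qed.

Lemma homog_cochain1 (D : {linear A -> B}) : homog 0 (cochain1 D).
Proof. by case=> [|a [|b s]]. Qed.

Lemma twilled_bracket1_linear (D : {linear A -> B}) a b :
  twilled_bracket1 (cochain1 D) [:: a; b] =
  rtri Q a (D b) + ltri Q (D a) b - D (mu Q a b).
Proof.
have D0 := extension_homog (homog_cochain1 D).
(* Elements of A are paired with 0 in B to evaluate the extension. *)
rewrite -[LHS]/([< m, ext (cochain1 D) >] [:: (a, 0); (b, 0)]).2.
rewrite (gerstenhaber_unary _ _ (cochain2_homog _) D0).
rewrite /= /mu_tri /extension_fun /=.
by rewrite !(linear0l, linear0r, add0r, addr0) /= (addrC (ltri _ _ _)).
Qed.

Lemma twilled_bracket2_linear (D : {linear A -> B}) a b :
  twilled_bracket2 (cochain1 D) (cochain1 D) [:: a; b] =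
  (nu Q (D a) (D b) - D (lharp Q a (D b)) - D (rharp Q (D a) b)) *+ 2.
Proof.
have D0 := extension_homog (homog_cochain1 D).
have n1 := cochain2_homog (nu_harp Q).
have nD := gerstenhaber_homog n1 D0.
rewrite -[LHS]/([< [< n, ext (cochain1 D) >], ext (cochain1 D) >]
  [:: (a, 0); (b, 0)]).2.
rewrite (gerstenhaber_unary _ _ nD D0) !(gerstenhaber_unary _ _ n1 D0).
rewrite /= /nu_harp /extension_fun /=.
rewrite !(linear0l, linear0r, linear0, add0r, addr0, subr0) !(linearD D) mulr2n.
by move: (D _) (D (rharp _ _ _)) (nu _ _ _) => u v w; abel.
Qed.

Lemma strong_deformation_mapP (D : {linear A -> B}) :
  strong_deformation_map Q D <->
  maurer_cartan (@cochain_deg K A B) twilled_brackets (cochain1 D).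
Proof.
have D0 : cochain_deg 0 (cochain1 D).
  by apply: homog_cochain_deg; apply: homog_cochain1.
set C := cochain2 (theta Q) + twilled_bracket1 (cochain1 D)
  + (2%:R)^-1 *: twilled_bracket2 (cochain1 D) (cochain1 D).
have CE a b : C [:: a; b] =
    nu Q (D a) (D b) + rtri Q a (D b) + ltri Q (D a) b + theta Q a b
    - D (mu Q a b + lharp Q a (D b) + rharp Q (D a) b).
  rewrite !cochainD cochainZ twilled_bracket1_linear twilled_bracket2_linear.
  rewrite -scaler_nat scalerA mulVf ?scale1r; last first.
    by have /pcharf0P -> := charK0.
  by rewrite !(linearD D) /=; abel.
have C1 : cochain_deg 1 C.
  have th1 : cochain_deg 1 (cochain2 (theta Q)).
    exact/homog_cochain_deg/cochain2_homog.
  have m1 : cochain_deg 1 (twilled_bracket1 (cochain1 D)).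
    apply: restriction_deg.
    exact: (gerstenhaber_deg (mu_tri_deg Q) (extension_deg D0)).
  have n1 : cochain_deg 1 (twilled_bracket2 (cochain1 D) (cochain1 D)).
    apply: restriction_deg; have eD0 := extension_deg D0.
    exact: (gerstenhaber_deg (gerstenhaber_deg (nu_harp_deg Q) eD0) eD0).
  by move=> s ns; rewrite !cochainD cochainZ th1 // m1 // n1 // scaler0 !addr0.
rewrite twilled_maurer_cartanE -/C; split=> [strong|[_ C0] a b].
  split=> //; apply: cochain_ext => s; rewrite cochain0.
  (* C has degree 1, so only the lists of size 2 matter. *)
  have [|ns] := eqVneq (size s)%:Z (1 + 1); last exact: C1.
  by case: s => [|a [|b [|c s]]] // _; rewrite CE strong subrr.
by apply/esym/subr0_eq; rewrite -CE C0.
Qed.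

End TwilledBrackets.

Theorem theorem5p1 (K : fieldType) (charK0 : [pchar K] =i pred0)
    (A B : lmodType K) (Q : quasi_twilled A B) :
  exists l : seq (cochain A B) -> cochain A B,
    [/\ [/\ l [::] = cochain2 (theta Q),
            forall f : cochain A B,
              extension (l [:: f]) =
              gerstenhaber (cochain2 (mu_tri Q)) (extension f),
            forall f g : cochain A B,
              extension (l [:: f; g]) =
              gerstenhaber
                (gerstenhaber (cochain2 (nu_harp Q)) (extension f))
                (extension g)
          & forall s : seq (cochain A B), (3 <= size s)%N -> l s = 0],
        curved_Linfty (@cochain_deg K A B) l
      & forall D : {linear A -> B},
          strong_deformation_map Q D <->
          maurer_cartan (@cochain_deg K A B) l (cochain1 D)].
Proof.
exists (twilled_brackets Q); split.
- split=> //; first exact: extension_bracket1.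
    exact: extension_bracket2.
  exact: twilled_brackets_large.
- exact: twilled_brackets_curved_Linfty.
- exact: strong_deformation_mapP.
Qed.
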